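(* Let $\mathbb{K}$ be an algebraically closed field, let $A$ be a $\mathbb{K}$-algebra which is a domain, let $\alpha$ be a $\mathbb{K}$-automorphism of $A$, let $u$ be a central element of $A$, let $v=u-\alpha(u)$ and let $R=R(A,\alpha,v,1)$ be the corresponding conformal ambiskew polynomial ring. Suppose that $A[y^{\pm 1};\alpha]$ is simple, that $Z(A[y^{\pm 1};\alpha])=\mathbb{K}$ and that, for all $m\geq 1$, there exists a non-zero polynomial $p_m(X)\in \mathbb{K}[X]$ such that $p_m(u)\in v^{(m)}A$, where $v^{(m)}=\sum_{l=0}^{m-1}\alpha^l(v)=u-\alpha^m(u)$. Then the height one prime ideals of $R$ are the ideals of the form $(z-\lambda)R$, $\lambda\in\mathbb{K}$, where $z$ is the Casimir element $xy-u$. Consequently $R$ is a UFD (in the sense of Chatters).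
   Context: Rings are associative with $1$. For a $\mathbb{K}$-algebra $A$, a $\mathbb{K}$-automorphism $\alpha$ of $A$ and a central element $v\in A$, the ambiskew polynomial algebra $R(A,\alpha,v,1)$ is the iterated skew polynomial ring $A[y;\alpha][x;\beta,\delta]$, where $\beta=\alpha^{-1}$ on $A$, $\beta(y)=y$, and $\delta$ is the $\beta$-derivation of $A[y;\alpha]$ with $\delta(A)=0$ and $\delta(y)=v$. Thus $ya=\alpha(a)y$ and $xa=\alpha^{-1}(a)x$ for all $a\in A$, and $xy=yx+v$. When $v=u-\alpha(u)$ with $u$ central in $A$, the ring is called conformal and the Casimir element $z=xy-u$ is central in $R$. The ring $A[y^{\pm 1};\alpha]$ is the skew Laurent polynomial ring with $ya=\alpha(a)y$, and $Z(\cdot)$ denotes the centre. An ideal $P$ of $R$ is completely prime if $R/P$ is a domain. A domain $R$ is a UFD in the sense of Chatters if it has at least one height one prime ideal and every height one prime ideal is completely prime and of the form $pR=Rp$ for some $p\in R$.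
   Formalization: The formal theorem adds the hypothesis v = u − α(u) ≠ 0; when v = 0 the claim always fails, since then u lies in K and (z+u)R = xyR is not prime (e.g. A = K(t), α(t) = qt with q not a root of unity, u = 0). *)

(* Defs.v *)
(* Skew Laurent polynomials reuse the additive group
   {malg A[int]} of finitely supported families from multinomials. *)
From HB Require Import structures.
From mathcomp Require Import all_boot all_algebra.
From mathcomp Require Import finmap monalg.

Set Implicit Arguments.
Unset Strict Implicit.
Unset Printing Implicit Defensive.

Import GRing.Theory.
Local Open Scope ring_scope.

(* Ideals are Prop-valued, since membership in an ideal of an arbitrary
   noncommutative ring need not be decidable. *)
Section IdealTheory.

Variable R : nzRingType.
Implicit Types (I J P : R -> Prop) (p u : R).

Definition central u : Prop := forall a, u * a = a * u.

Definition is_domain : Prop := forall a b : R, a * b = 0 -> a = 0 \/ b = 0.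

Record is_ideal I : Prop := IsIdeal {
  ideal0 : I 0;
  idealD : forall a b, I a -> I b -> I (a + b);
  idealMl : forall r a, I a -> I (r * a);
  idealMr : forall r a, I a -> I (a * r) }.

Definition ideal_sub I J : Prop := forall a, I a -> J a.
Definition ideal_eq I J : Prop := forall a, I a <-> J a.
Definition ideal_lt I J : Prop := ideal_sub I J /\ ~ ideal_sub J I.

Definition simple_ring : Prop :=
  forall I, is_ideal I -> (forall a, I a -> a = 0) \/ (forall a, I a).

(* The hypothesis on I and J says that the product ideal IJ lies in P. *)
Definition prime_ideal P : Prop :=
  [/\ is_ideal P, ~ P 1 &
      forall I J, is_ideal I -> is_ideal J ->
        (forall a b, I a -> J b -> P (a * b)) -> ideal_sub I P \/ ideal_sub J P].

(* R/P is a (nonzero) domain. *)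
Definition completely_prime P : Prop :=
  [/\ is_ideal P, ~ P 1 & forall a b, P (a * b) -> P a \/ P b].

(* There are primes Q_0 < Q_1 < ... < Q_n = P. *)
Definition prime_chain P (n : nat) : Prop :=
  exists Q : nat -> R -> Prop,
    [/\ forall i, (i <= n)%N -> prime_ideal (Q i),
        forall i, (i < n)%N -> ideal_lt (Q i) (Q i.+1) &
        ideal_eq (Q n) P].

Definition height P (n : nat) : Prop :=
  prime_chain P n /\ ~ prime_chain P n.+1.

Definition height_one_prime P : Prop := prime_ideal P /\ height P 1.

Definition right_multiples p : R -> Prop := fun a => exists r, a = p * r.
Definition left_multiples p : R -> Prop := fun a => exists r, a = r * p.

Definition chatters_ufd : Prop :=
  [/\ is_domain,
      exists P, height_one_prime P &
      forall P, height_one_prime P ->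
        completely_prime P /\
        exists p, ideal_eq P (right_multiples p) /\
                  ideal_eq P (left_multiples p)].

End IdealTheory.

Arguments is_domain : clear implicits.
Arguments simple_ring : clear implicits.
Arguments chatters_ufd : clear implicits.

(* The Ore extension B[x; s, d]: left B-module {poly B} with 'X as x. *)

Record skew_data (B : nzRingType) := SkewData {
  sk_end : {rmorphism B -> B};
  sk_der : {additive B -> B};
  sk_derM : forall a b, sk_der (a * b) = sk_end a * sk_der b + sk_der a * b }.

Definition skew_poly (B : nzRingType) (D : skew_data B) := {poly B}.

Section SkewPoly.

Variables (B : nzRingType) (D : skew_data B).

Local Notation s := (sk_end D).
Local Notation d := (sk_der D).

HB.instance Definition _ := GRing.Zmodule.copy (skew_poly D) {poly B}.

(* Left multiplication by x: it sends q = \sum_j q_j x^j to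
   \sum_j (s(q_j) x + d(q_j)) x^j. *)
Definition skew_Xmul (q : {poly B}) : {poly B} :=
  map_poly s q * 'X + map_poly d q.

Definition skew_mul (p q : {poly B}) : {poly B} :=
  \sum_(i < size p) p`_i *: iter i skew_Xmul q.

Fact skew_Xmul_is_zmod_morphism : zmod_morphism skew_Xmul.
Proof.
by move=> p q; rewrite /skew_Xmul !raddfB mulrBl /= opprD addrACA.
Qed.

HB.instance Definition _ :=
  GRing.isZmodMorphism.Build {poly B} {poly B} skew_Xmul
    skew_Xmul_is_zmod_morphism.

Lemma iter_skew_XmulD i (p q : {poly B}) :
  iter i skew_Xmul (p + q) = iter i skew_Xmul p + iter i skew_Xmul q.
Proof. by elim: i => //= i ->; rewrite raddfD. Qed.

Lemma iter_skew_Xmul0 i : iter i skew_Xmul 0 = 0.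
Proof. by elim: i => //= i ->; rewrite raddf0. Qed.

Lemma skew_mulE n (p q : {poly B}) : (size p <= n)%N ->
  skew_mul p q = \sum_(i < n) p`_i *: iter i skew_Xmul q.
Proof.
move=> le_p_n; rewrite /skew_mul (big_ord_widen n (fun i => p`_i *: iter i skew_Xmul q)) //.
rewrite big_mkcond; apply: eq_bigr => i _; case: ltnP => // le_p_i.
by rewrite nth_default // scale0r.
Qed.

Lemma skew_mulDl : left_distributive skew_mul +%R.
Proof.
move=> p1 p2 q; set n := maxn (size p1) (size p2).
rewrite (@skew_mulE n) ?size_polyD // (@skew_mulE n p1) ?leq_maxl //.
rewrite (@skew_mulE n p2) ?leq_maxr // -big_split; apply: eq_bigr => i _.
by rewrite coefD scalerDl.
Qed.

Lemma skew_mulDr : right_distributive skew_mul +%R.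
Proof.
move=> p q1 q2; rewrite /skew_mul -big_split; apply: eq_bigr => i _.
by rewrite iter_skew_XmulD scalerDr.
Qed.

Lemma skew_mul0l (q : {poly B}) : skew_mul 0 q = 0.
Proof. by rewrite /skew_mul size_poly0 big_ord0. Qed.

Lemma skew_mulC a (q : {poly B}) : skew_mul a%:P q = a *: q.
Proof. by rewrite (@skew_mulE 1) ?size_polyC_leq1 // big_ord1 coefC eqxx. Qed.

Lemma skew_mul1l : left_id 1%:P skew_mul.
Proof. by move=> q; rewrite skew_mulC scale1r. Qed.

Lemma sk_der1 : d 1 = 0.
Proof.
have := sk_derM D 1 1; rewrite !mulr1 rmorph1 mul1r => /eqP.
by rewrite -subr_eq subrr eq_sym => /eqP.
Qed.

Lemma iter_skew_Xmul1 i : iter i skew_Xmul 1%:P = 'X^i.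
Proof.
elim: i => [|i IHi]; first by rewrite expr0.
rewrite /= IHi /skew_Xmul map_polyXn exprSr -[RHS]addr0; congr (_ + _).
apply/polyP => j; rewrite coef_map coefXn coef0.
by case: eqP => _; rewrite ?sk_der1 ?raddf0.
Qed.

Lemma skew_mul1r : right_id 1%:P skew_mul.
Proof.
move=> p; rewrite -[RHS]coefK poly_def /skew_mul.
by apply: eq_bigr => i _; rewrite iter_skew_Xmul1.
Qed.

Lemma skew_Xmul_scale a (q : {poly B}) :
  skew_Xmul (a *: q) = s a *: skew_Xmul q + d a *: q.
Proof.
apply/polyP => j; rewrite /skew_Xmul !(coefD, coefZ, coef_map, coefMX) /=.
rewrite sk_derM mulrDr addrA; case: j => [|j] /=; first by rewrite mulr0.
by rewrite rmorphM.
Qed.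

Lemma skew_mulZl a (p q : {poly B}) : skew_mul (a *: p) q = a *: skew_mul p q.
Proof.
rewrite (@skew_mulE (size p)) ?size_scale_leq // /skew_mul scaler_sumr.
by apply: eq_bigr => i _; rewrite coefZ scalerA.
Qed.

Lemma skew_mulMX (p q : {poly B}) : skew_mul (p * 'X) q = skew_mul p (skew_Xmul q).
Proof.
rewrite (@skew_mulE (size p).+1); last first.
  by rewrite (leq_trans (size_polyMleq _ _)) // size_polyX addn2.
rewrite big_ord_recl coefMX scale0r add0r; apply: eq_bigr => i _.
by rewrite coefMX -iterSr.
Qed.

Lemma skew_Xmul_mul (p q : {poly B}) : skew_Xmul (skew_mul p q) = skew_mul (skew_Xmul p) q.
Proof.
rewrite {1}/skew_mul raddf_sum [in RHS]/skew_Xmul skew_mulDl skew_mulMX.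
rewrite (@skew_mulE (size p) (map_poly s p)) ?size_poly //.
rewrite (@skew_mulE (size p) (map_poly d p)) ?size_poly // -big_split.
by apply: eq_bigr => i _; rewrite !coef_map -iterSr /= skew_Xmul_scale.
Qed.

Lemma skew_mulA : associative skew_mul.
Proof.
move=> p q r; elim/poly_ind: p q => [|p a IHp] q; first by rewrite !skew_mul0l.
rewrite !skew_mulDl !skew_mulMX !skew_mulC skew_mulZl skew_Xmul_mul.
by rewrite IHp.
Qed.

HB.instance Definition _ := GRing.Zmodule_isNzRing.Build (skew_poly D)
  skew_mulA skew_mul1l skew_mul1r skew_mulDl skew_mulDr (oner_neq0 {poly B}).

End SkewPoly.

Definition skewC (B : nzRingType) (D : skew_data B) (b : B) : skew_poly D :=
  b%:P.
Definition skewX (B : nzRingType) (D : skew_data B) : skew_poly D := 'X.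

Lemma skewX_comm (B : nzRingType) (D : skew_data B) (b : B) :
  skewX D * skewC D b =
  skewC D (sk_end D b) * skewX D + skewC D (sk_der D b).
Proof.
rewrite /GRing.mul /= /skewX -[X in skew_mul D X _]mul1r.
rewrite skew_mulMX skew_mul1l skew_mulC /skew_Xmul.
by rewrite !map_polyC /= mul_polyC.
Qed.

Lemma skewC_is_zmod_morphism (B : nzRingType) (D : skew_data B) :
  zmod_morphism (skewC D).
Proof. by move=> a b; rewrite /skewC rmorphB. Qed.

Lemma skewC_is_monoid_morphism (B : nzRingType) (D : skew_data B) :
  monoid_morphism (skewC D).
Proof.
split=> // a b; rewrite {2}/GRing.mul /= skew_mulC.
by rewrite /skewC polyCM mul_polyC.
Qed.

HB.instance Definition _ (B : nzRingType) (D : skew_data B) :=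
  GRing.isZmodMorphism.Build B (skew_poly D) (skewC D)
    (@skewC_is_zmod_morphism B D).
HB.instance Definition _ (B : nzRingType) (D : skew_data B) :=
  GRing.isMonoidMorphism.Build B (skew_poly D) (skewC D)
    (@skewC_is_monoid_morphism B D).

Lemma skew_polyE (B : nzRingType) (D : skew_data B) (p : skew_poly D) :
  p = \sum_(i < size (p : {poly B})) skewC D (p : {poly B})`_i * skewX D ^+ i.
Proof.
have skewXn i : skewX D ^+ i = ('X^i : {poly B}).
  rewrite -(iter_skew_Xmul1 D); elim: i => [|i IHi] //.
  rewrite exprS IHi /= /GRing.mul /= /skewX -[X in skew_mul D X _]mul1r.
  by rewrite skew_mulMX skew_mul1l.
rewrite -[LHS]coefK poly_def; apply: eq_bigr => i _.
by rewrite skewXn [in RHS]/GRing.mul /= skew_mulC.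
Qed.

(* K-algebra automorphisms. *)
Record alg_aut (K : nzRingType) (A : algType K) := AlgAut {
  aut_fun :> {lrmorphism A -> A};
  aut_inv : A -> A;
  autK : cancel aut_fun aut_inv;
  aut_invK : cancel aut_inv aut_fun }.

Section Ambiskew.

Variables (K : nzRingType) (A : algType K) (alpha : alg_aut A).

Local Notation alphaV := (aut_inv alpha).

HB.instance Definition _ :=
  GRing.isZmodMorphism.Build A A alphaV
    (can2_zmod_morphism (autK alpha) (aut_invK alpha)).
HB.instance Definition _ :=
  GRing.isMonoidMorphism.Build A A alphaV
    (can2_monoid_morphism (autK alpha) (aut_invK alpha)).

Fact zero_derM (a b : A) :
  (\0 : {additive A -> A}) (a * b) =
  (alpha : {rmorphism A -> A}) a * (\0 : {additive A -> A}) b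
  + (\0 : {additive A -> A}) a * b.
Proof. by rewrite /= mulr0 mul0r addr0. Qed.

(* A[y; alpha] *)
Definition skewA : skew_data A := SkewData zero_derM.
Notation Ay := (skew_poly skewA).
Local Notation y := (skewX skewA).
Local Notation "a %:Ay" := (skewC skewA a) (at level 2).

Lemma skewA_comm (a : A) : y * a%:Ay = (alpha a)%:Ay * y.
Proof. by rewrite skewX_comm /= raddf0 addr0. Qed.

Lemma skewA_ind (Q : Ay -> Prop) :
  Q 0 -> (forall p a, Q p -> Q (p * y + a%:Ay)) -> forall p, Q p.
Proof.
move=> Q0 QS; elim/poly_ind => // p a /(QS _ a).
suff -> : (p : Ay) * y = (p * 'X)%R :> {poly A} by [].
rewrite [LHS]/GRing.mul /= -[p in RHS](@skew_mul1r _ skewA).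
rewrite /skew_mul mulr_suml; apply: eq_bigr => i _.
rewrite iter_skew_Xmul1 -scalerAl -exprSr; congr (_ *: _).
rewrite -(iter_skew_Xmul1 skewA) iterSr; congr iter.
by rewrite -[skewX _]/'X -['X]expr1 -(iter_skew_Xmul1 skewA).
Qed.

(* beta extends alpha^-1 by beta(y) = y. *)
Definition ambi_beta (p : Ay) : Ay := map_poly alphaV p.

Fact ambi_beta_is_zmod_morphism : zmod_morphism ambi_beta.
Proof. by move=> p q; rewrite /ambi_beta raddfB. Qed.

HB.instance Definition _ :=
  GRing.isZmodMorphism.Build Ay Ay ambi_beta ambi_beta_is_zmod_morphism.

Lemma ambi_betaC a : ambi_beta a%:Ay = (alphaV a)%:Ay.
Proof. exact: map_polyC. Qed.

Lemma ambi_betaX : ambi_beta y = y.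
Proof. exact: map_polyX. Qed.

Lemma coef_ymul (p : Ay) i :
  (y * p : {poly A})`_i = if i is j.+1 then alpha (p : {poly A})`_j else 0.
Proof.
rewrite /GRing.mul /= /skewX -[X in skew_mul _ X _]mul1r.
rewrite skew_mulMX skew_mul1l /skew_Xmul coefD coefMX !coef_map /= addr0.
by case: i => //= i; rewrite coef_map.
Qed.

Lemma coef_Cmul a (p : Ay) i : (a%:Ay * p : {poly A})`_i = a * (p : {poly A})`_i.
Proof. by rewrite /GRing.mul /= skew_mulC coefZ. Qed.

Lemma ambi_betaCM a q : ambi_beta (a%:Ay * q) = ambi_beta a%:Ay * ambi_beta q.
Proof.
apply/polyP => i; rewrite ambi_betaC coef_Cmul.
by rewrite !coef_map coef_Cmul /= rmorphM.
Qed.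

Lemma ambi_betaXM q : ambi_beta (y * q) = ambi_beta y * ambi_beta q.
Proof.
rewrite ambi_betaX; apply/polyP => i; rewrite coef_map !coef_ymul.
by case: i => [|i] /=; rewrite ?raddf0 // coef_map autK /= aut_invK.
Qed.

Fact ambi_beta_is_monoid_morphism : monoid_morphism ambi_beta.
Proof.
split; first by rewrite [LHS](@ambi_betaC 1) rmorph1.
elim/skewA_ind => [|p a IHp] q; first by rewrite raddf0 !mul0r raddf0.
rewrite mulrDl !raddfD /= mulrDl ambi_betaCM -mulrA !IHp ambi_betaXM.
by rewrite mulrA.
Qed.

HB.instance Definition _ :=
  GRing.isMonoidMorphism.Build Ay Ay ambi_beta ambi_beta_is_monoid_morphism.

(* v^(m) = v + alpha(v) + ... + alpha^(m-1)(v) *)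
Definition vsum (v : A) (m : nat) : A := \sum_(l < m) iter l alpha v.

(* The beta-derivation with delta(A) = 0 and delta(y) = v; by the Leibniz rule
   delta(a y^i) = alpha^-1(a) v^(i) y^(i-1). *)
Definition ambi_delta (v : A) (p : Ay) : Ay :=
  \poly_(i < size (p : {poly A}))
     (alphaV (p : {poly A})`_i.+1 * vsum v i.+1).

Lemma coef_ambi_delta v (p : Ay) i :
  (ambi_delta v p : {poly A})`_i = alphaV (p : {poly A})`_i.+1 * vsum v i.+1.
Proof.
rewrite coef_poly; case: ltnP => // le_p_i.
by rewrite nth_default ?raddf0 ?mul0r // ltnW.
Qed.

Fact ambi_delta_is_zmod_morphism v : zmod_morphism (ambi_delta v).
Proof.
move=> p q; apply/polyP => i.
by rewrite coefB !coef_ambi_delta coefB raddfB mulrBl.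
Qed.

HB.instance Definition _ v :=
  GRing.isZmodMorphism.Build Ay Ay (ambi_delta v)
    (ambi_delta_is_zmod_morphism v).

Lemma ambi_deltaC v a : ambi_delta v a%:Ay = 0.
Proof.
by apply/polyP => i; rewrite coef_ambi_delta coefC /= raddf0 mul0r coef0.
Qed.

Lemma ambi_deltaX v : ambi_delta v y = v%:Ay.
Proof.
apply/polyP => i; rewrite coef_ambi_delta coefX coefC eqSS.
case: eqP => [->|_]; last by rewrite raddf0 mul0r.
by rewrite rmorph1 mul1r /vsum big_ord1.
Qed.

Fact ambi_deltaM v : central v -> forall p q : Ay,
  ambi_delta v (p * q) = ambi_beta p * ambi_delta v q + ambi_delta v p * q.
Proof.
move=> cv.
have dC a q : ambi_delta v (a%:Ay * q) = (alphaV a)%:Ay * ambi_delta v q.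
  apply/polyP => i; rewrite coef_ambi_delta !coef_Cmul coef_ambi_delta.
  by rewrite rmorphM mulrA.
have dX q : ambi_delta v (y * q) = y * ambi_delta v q + v%:Ay * q.
  apply/polyP => i; rewrite coef_ambi_delta coefD coef_Cmul !coef_ymul autK.
  case: i => [|i]; first by rewrite /vsum big_ord1 add0r -cv.
  rewrite coef_ambi_delta rmorphM /= aut_invK /vsum big_ord_recl raddf_sum mulrDr.
  by rewrite -cv addrC.
elim/skewA_ind => [|p a IHp] q; first by rewrite !raddf0 !mul0r raddf0 addr0.
rewrite mulrDl !raddfD /= -mulrA !IHp !mulrDl dC dX ambi_deltaC ambi_deltaX.
rewrite rmorphM /= ambi_betaX ambi_betaC mul0r addr0 mulrDr !mulrA -!addrA.
by congr (_ + _); rewrite [RHS]addrC -addrA.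
Qed.

(* R(A, alpha, v, 1) = A[y; alpha][x; beta, delta], for v central in A *)
Definition ambiskew_data (v : A) (cv : central v) : skew_data Ay :=
  @SkewData Ay ambi_beta (ambi_delta v) (ambi_deltaM cv).

Definition ambiskew (v : A) (cv : central v) := skew_poly (ambiskew_data cv).

HB.instance Definition _ v (cv : central v) :=
  GRing.NzRing.copy (ambiskew cv) (skew_poly (ambiskew_data cv)).

Section Generators.

Variables (v : A) (cv : central v).

Definition ambiC (a : A) : ambiskew cv := skewC (ambiskew_data cv) a%:Ay.
Definition ambiY : ambiskew cv := skewC (ambiskew_data cv) y.
Definition ambiX : ambiskew cv := skewX (ambiskew_data cv).

HB.instance Definition _ := GRing.RMorphism.copy ambiC
  (skewC (ambiskew_data cv) \o skewC skewA).

Lemma ambiY_comm a : ambiY * ambiC a = ambiC (alpha a) * ambiY.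
Proof.
by have := congr1 (skewC (ambiskew_data cv)) (skewA_comm a); rewrite !rmorphM.
Qed.

Lemma ambiX_comm a : ambiX * ambiC a = ambiC (alphaV a) * ambiX.
Proof. by rewrite [LHS]skewX_comm /= ambi_betaC ambi_deltaC raddf0 addr0. Qed.

Lemma ambiXY : ambiX * ambiY = ambiY * ambiX + ambiC v.
Proof. by rewrite [LHS]skewX_comm /= ambi_betaX ambi_deltaX. Qed.

End Generators.

(* The conformal case v = u - alpha(u). *)
Fact central_conformal (u : A) : central u -> central (u - alpha u).
Proof.
move=> cu a; rewrite mulrBl mulrBr cu; congr (_ - _).
by rewrite -[a](aut_invK alpha) -!rmorphM cu.
Qed.

Definition casimir (u : A) (cu : central u) :
    ambiskew (central_conformal cu) :=
  ambiX (central_conformal cu) * ambiY (central_conformal cu)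
  - ambiC (central_conformal cu) u.

(* alpha^i for i an integer *)
Definition aut_pow (i : int) : A -> A :=
  match i with
  | Posz n => iter n alpha
  | Negz n => iter n.+1 alphaV
  end.

Lemma aut_powS i a : aut_pow (i + 1) a = alpha (aut_pow i a).
Proof.
case: i => [n|[|n]]; first by rewrite (_ : n%:Z + 1 = n.+1) // addrC.
  by rewrite /= aut_invK.
rewrite (_ : Negz n.+1 + 1 = Negz n) /= ?aut_invK //.
by rewrite !NegzE -addn1 PoszD opprD addrNK.
Qed.

Lemma aut_powD i j a : aut_pow (i + j) a = aut_pow i (aut_pow j a).
Proof.
have aut_powB k b : aut_pow (k - 1) b = alphaV (aut_pow k b).
  by rewrite -{2}[k](subrK 1) aut_powS autK.
elim/int_rect: i => [|n IHn|n IHn]; first by rewrite add0r.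
  by rewrite -addn1 PoszD addrAC !aut_powS IHn.
by rewrite -addn1 PoszD opprD addrAC !aut_powB IHn.
Qed.

Fact aut_pow_is_zmod_morphism i : zmod_morphism (aut_pow i).
Proof.
have h1 n : zmod_morphism (iter n alpha).
  by move=> a b; elim: n => //= n ->; rewrite raddfB.
have h2 n : zmod_morphism (iter n alphaV).
  by move=> a b; elim: n => //= n ->; rewrite raddfB.
by case: i => n a b; rewrite [LHS](h1, h2).
Qed.

Fact aut_pow_is_monoid_morphism i : monoid_morphism (aut_pow i).
Proof.
have h1 n : monoid_morphism (iter n alpha).
  elim: n => //= n [h hM].
  by split=> [|a b] /=; [rewrite h rmorph1|rewrite hM rmorphM].
have h2 n : monoid_morphism (iter n alphaV).
  elim: n => //= n [h hM].
  by split=> [|a b] /=; [rewrite h rmorph1|rewrite hM rmorphM].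
by case: i => n; [exact: (h1 n)|exact: (h2 n.+1)].
Qed.

HB.instance Definition _ i :=
  GRing.isZmodMorphism.Build A A (aut_pow i) (aut_pow_is_zmod_morphism i).
HB.instance Definition _ i :=
  GRing.isMonoidMorphism.Build A A (aut_pow i) (aut_pow_is_monoid_morphism i).

End Ambiskew.

(* A[y^{+-1}; alpha]: the monomial << a *g i >> stands for a y^i. *)
Definition laurent (K : nzRingType) (A : algType K) (alpha : alg_aut A) :=
  {malg A[int]}.

Section Laurent.

Variables (K : nzRingType) (A : algType K) (alpha : alg_aut A).

Implicit Types f g h : {malg A[int]}.

HB.instance Definition _ := GRing.Zmodule.copy (laurent alpha) {malg A[int]}.

(* (a y^i)(b y^j) = a alpha^i(b) y^(i+j) *)
Definition laur_mul f g : {malg A[int]} :=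
  \sum_(i <- msupp f) \sum_(j <- msupp g)
     << f@_i * aut_pow alpha i g@_j *g i + j >>.

Definition laur_one : {malg A[int]} := << 1 *g 0 >>.

Lemma laur_mulE (d1 d2 : {fset int}) f g :
  (msupp f `<=` d1)%fset -> (msupp g `<=` d2)%fset ->
  laur_mul f g = \sum_(i <- d1) \sum_(j <- d2)
     << f@_i * aut_pow alpha i g@_j *g i + j >>.
Proof.
move=> le1 le2; rewrite /laur_mul (big_fset_incl _ le1) /= => [|i _ Ni]; last first.
  by rewrite big1 // => j _; rewrite mcoeff_outdom // mul0r monalgU0.
apply: eq_bigr => i _; rewrite (big_fset_incl _ le2) //= => j _ Nj.
by rewrite [g@_j]mcoeff_outdom // raddf0 mulr0 monalgU0.
Qed.

Lemma laur_mulUU a b i j :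
  laur_mul << a *g i >> << b *g j >> = << a * aut_pow alpha i b *g i + j >>.
Proof.
by rewrite (laur_mulE msuppU_le msuppU_le) !big_seq_fset1 !mcoeffUU.
Qed.

Lemma laur_mulDl : left_distributive laur_mul +%R.
Proof.
move=> f g h; set d := (msupp f `|` msupp g)%fset.
rewrite (@laur_mulE d (msupp h)) ?msuppD_le ?fsubset_refl //.
rewrite (@laur_mulE d (msupp h) f) ?fsubsetUl ?fsubset_refl //.
rewrite (@laur_mulE d (msupp h) g) ?fsubsetUr ?fsubset_refl //.
rewrite -big_split; apply: eq_bigr => i _; rewrite -big_split.
by apply: eq_bigr => j _; rewrite mcoeffD mulrDl monalgUD.
Qed.

Lemma laur_mulDr : right_distributive laur_mul +%R.
Proof.
move=> h f g; set d := (msupp f `|` msupp g)%fset.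
rewrite (@laur_mulE (msupp h) d) ?msuppD_le ?fsubset_refl //.
rewrite (@laur_mulE (msupp h) d h f) ?fsubsetUl ?fsubset_refl //.
rewrite (@laur_mulE (msupp h) d h g) ?fsubsetUr ?fsubset_refl //.
rewrite -big_split; apply: eq_bigr => i _; rewrite -big_split.
by apply: eq_bigr => j _; rewrite mcoeffD raddfD mulrDr monalgUD.
Qed.

Lemma laur_mul0l f : laur_mul 0 f = 0.
Proof. by rewrite /laur_mul msupp0 big_seq_fset0. Qed.

Lemma laur_mul0r f : laur_mul f 0 = 0.
Proof. by rewrite /laur_mul big1 // => i _; rewrite msupp0 big_seq_fset0. Qed.

Lemma laur_ind (Q : {malg A[int]} -> Prop) :
  Q 0 -> (forall f g, Q f -> Q g -> Q (f + g)) ->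
  (forall a i, Q << a *g i >>) -> forall f, Q f.
Proof. by move=> Q0 QD QU f; rewrite [f]monalgE; apply: big_ind. Qed.

Lemma laur_mulA : associative laur_mul.
Proof.
move=> f g h; elim/laur_ind: f => [|f1 f2 IH1 IH2|a i].
- by rewrite !laur_mul0l.
- by rewrite !laur_mulDl IH1 IH2.
elim/laur_ind: g => [|g1 g2 IH1 IH2|b j].
- by rewrite laur_mul0r !laur_mul0l laur_mul0r.
- by rewrite laur_mulDr !laur_mulDl laur_mulDr IH1 IH2.
elim/laur_ind: h => [|h1 h2 IH1 IH2|c k].
- by rewrite !laur_mul0r.
- by rewrite !laur_mulDr IH1 IH2.
by rewrite !laur_mulUU rmorphM /= aut_powD mulrA addrA.
Qed.

Lemma laur_mul1l : left_id laur_one laur_mul.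
Proof.
elim/laur_ind => [|f g IHf IHg|a i]; first by rewrite laur_mul0r.
  by rewrite laur_mulDr IHf IHg.
by rewrite laur_mulUU mul1r add0r.
Qed.

Lemma laur_mul1r : right_id laur_one laur_mul.
Proof.
elim/laur_ind => [|f g IHf IHg|a i]; first by rewrite laur_mul0l.
  by rewrite laur_mulDl IHf IHg.
by rewrite laur_mulUU rmorph1 mulr1 addr0.
Qed.

Lemma laur_one_neq0 : laur_one != 0.
Proof. by rewrite monalgU_eq0 oner_neq0. Qed.

HB.instance Definition _ := GRing.Zmodule_isNzRing.Build (laurent alpha)
  laur_mulA laur_mul1l laur_mul1r laur_mulDl laur_mulDr laur_one_neq0.

Definition laurC (a : A) : laurent alpha := << a *g 0 >>.
Definition laurY (i : int) : laurent alpha := << 1 *g i >>.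

Lemma laurYD i j : laurY (i + j) = laurY i * laurY j.
Proof. by rewrite [RHS]laur_mulUU rmorph1 mul1r. Qed.

Lemma laurY_comm a : laurY 1 * laurC a = laurC (alpha a) * laurY 1.
Proof. by rewrite [LHS]laur_mulUU [RHS]laur_mulUU mul1r mulr1 addr0 add0r. Qed.

Lemma laurE (f : laurent alpha) :
  f = \sum_(i <- msupp f) laurC (f : {malg A[int]})@_i * laurY i.
Proof.
rewrite [LHS]monalgE; apply: eq_bigr => i _.
by rewrite [RHS]laur_mulUU mulr1 add0r.
Qed.

End Laurent.

(* Main.v *)
(* Let L = A[y^{+-1}; alpha]. Sending x to (Z + u) y^-1 embeds R into L[Z], with
   z mapped to Z. Specializing Z at l in K gives a map from R to the domain L
   whose kernel is (z - l)R, by the normal form r = (z - l) r' + p(y) + q(x) x;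
   hence (z - l)R is completely prime. Conversely, a nonzero ideal I of R
   generates a nonzero ideal of L[Z] after inverting y; since L is simple with
   centre K, that ideal contains a nonzero element of K[Z], so y^m f(z) lies in
   I for some m and some nonzero f in K[X]. The identity
   x y^m - y^m x = v^(m) y^(m-1), together with x y^m = (z + u) y^(m-1), then
   puts p_m(-z) y^(m-1) f(z) in I, so m can be lowered to 0. When I is prime,
   factoring f over K shows that I contains some z - l. *)
Require Import Defs.
From HB Require Import structures.
From mathcomp Require Import all_boot all_algebra.
From mathcomp Require Import monalg zify.
From Stdlib Require Import Classical.
From Stdlib Require Import FunctionalExtensionality PropExtensionality.

Set Implicit Arguments.
Unset Strict Implicit.
Unset Printing Implicit Defensive.

Import GRing.Theory.
Local Open Scope ring_scope.

(** * Degrees and zero divisors in Ore extensions *)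

Section SkewPolyTheory.

Variables (B : nzRingType) (D : skew_data B).
Implicit Types p q : skew_poly D.

Local Notation s := (sk_end D).
Local Notation d := (sk_der D).

Lemma skewC_mulE a p : skewC D a * p = a *: (p : {poly B}) :> {poly B}.
Proof. exact: skew_mulC. Qed.

Lemma skewX_mulE p : skewX D * p = skew_Xmul D p.
Proof.
rewrite /GRing.mul /= /skewX -[X in skew_mul D X _]mul1r.
by rewrite skew_mulMX skew_mul1l.
Qed.

Lemma skewXn_mulE i p : skewX D ^+ i * p = iter i (skew_Xmul D) p.
Proof.
by elim: i => [|i IHi]; rewrite ?expr0 ?mul1r // exprS -mulrA IHi skewX_mulE.
Qed.

Lemma skew_monomial_ind (Q : skew_poly D -> Prop) :
    Q 0 -> (forall p q, Q p -> Q q -> Q (p + q)) ->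
    (forall b i, Q (skewC D b * skewX D ^+ i)) ->
  forall p, Q p.
Proof. by move=> Q0 QD QM p; rewrite (skew_polyE p); apply: big_ind. Qed.

(** Left multiplication by x raises a degree bound by one, and the [d] part stays below the new top
    position, whose coefficient is therefore only twisted by [s]. Here [n] is a bound, so that
    coefficient may vanish. *)
Lemma coef_iter_skew_Xmul i (q : {poly B}) n : (size q <= n.+1)%N ->
  (size (iter i (skew_Xmul D) q) <= (i + n).+1)%N /\
  (iter i (skew_Xmul D) q)`_(i + n) = iter i s q`_n.
Proof.
move=> le_q; elim: i => [|i [IHs IHc]] //=; split.
  apply/leq_sizeP => j lt_j; rewrite /skew_Xmul coefD coefMX !coef_map.
  case: j lt_j => // j lt_j /=.
  by rewrite !nth_default ?raddf0 ?addr0 // (leq_trans IHs) // ltnW.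
rewrite /skew_Xmul coefD coefMX !coef_map addSn /= IHc.
by rewrite (nth_default _ IHs) raddf0 addr0.
Qed.

Hypothesis s_inj : injective s.
Hypothesis B_domain : is_domain B.

(** The coefficient of the product in degree [m + n] is [p_m * s^m(q_n)]; it is nonzero because [s]
    is injective and [B] is a domain, so degrees add as for ordinary polynomials. *)
Lemma size_skew_mul p q : p != 0 -> q != 0 ->
  size (p * q : {poly B}) = (size (p : {poly B}) + size (q : {poly B})).-1.
Proof.
rewrite -![_ != 0](size_poly_gt0 (_ : {poly B})).
case def_m: (size (p : {poly B})) => [|m] // _.
case def_n: (size (q : {poly B})) => [|n] // _.
have le_q : (size (q : {poly B}) <= n.+1)%N by rewrite def_n.
have pq_le : (size ((p * q)%R : {poly B}) <= (m + n).+1)%N.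
  rewrite /GRing.mul /= (@skew_mulE _ _ m.+1) ?def_m //.
  apply: (leq_trans (size_sum _ _ _)); apply/bigmax_leqP => i _.
  apply: (leq_trans (size_scale_leq _ _)).
  have [le_it _] := coef_iter_skew_Xmul i le_q; apply: leq_trans le_it _.
  by rewrite ltnS leq_add2r -ltnS ltn_ord.
have pq_coef : (p * q : {poly B})`_(m + n) =
    (p : {poly B})`_m * iter m s (q : {poly B})`_n.
  rewrite /GRing.mul /= (@skew_mulE _ _ m.+1) ?def_m // coef_sum.
  rewrite big_ord_recr /=.
  rewrite coefZ (coef_iter_skew_Xmul m le_q).2 big1 ?add0r // => i _.
  rewrite coefZ [X in _ * X]nth_default ?mulr0 //.
  have [le_it _] := coef_iter_skew_Xmul i le_q; apply: leq_trans le_it _.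
  by rewrite ltn_add2r.
apply/eqP; rewrite addSn addnS /= eqn_leq pq_le ltnNge; apply/negP.
move=> /leq_sizeP/(_ _ (leqnn _)); rewrite pq_coef => /B_domain.
have lead0 (r : {poly B}) k : size r = k.+1 -> r`_k = 0 -> False.
  move=> r_size r0; have : r != 0 by rewrite -size_poly_gt0 r_size.
  by rewrite -lead_coef_eq0 lead_coefE r_size r0 eqxx.
case=> [/(lead0 _ _ def_m) // | iter0]; apply: (lead0 _ _ def_n).
elim: m iter0 {def_m pq_le pq_coef} => //= k IHk iter0.
by apply: IHk; apply: s_inj; rewrite iter0 rmorph0.
Qed.

Lemma skew_poly_domain : is_domain (skew_poly D).
Proof.
move=> p q pq0; have [->|p0] := eqVneq p 0; first by left.
have [->|q0] := eqVneq q 0; first by right.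
have /eqP := size_skew_mul p0 q0; rewrite pq0 size_poly0.
move: p0 q0; rewrite -![_ != 0](size_poly_gt0 (_ : {poly B})).
by case: size => // m _; case: size => // n _; rewrite addSn addnS.
Qed.

End SkewPolyTheory.

(** * Evaluation morphisms out of an Ore extension *)

Section SkewEval.

Variables (B S : nzRingType) (D : skew_data B).
Variables (f : {rmorphism B -> S}) (c : S).

Local Notation s := (sk_end D).
Local Notation d := (sk_der D).

(** The defining relation x b = s(b) x + d(b), transported along [f] with [c] as the image of x. *)
Definition skew_compatible : Prop :=
  forall b, c * f b = f (s b) * c + f (d b).

(** Coefficients stand to the left of x, so ordinary evaluation [sum f(p_i) c^i] is the right
    formula. Compatibility is an argument so that the map can be declared a ring morphism. *)
Definition skew_eval (_ : skew_compatible) (p : skew_poly D) : S :=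
  (map_poly f p).[c].

Hypothesis cf : skew_compatible.

Fact skew_eval_is_zmod_morphism : zmod_morphism (skew_eval cf).
Proof. by move=> p q; rewrite /skew_eval raddfB hornerD hornerN. Qed.

HB.instance Definition _ := GRing.isZmodMorphism.Build (skew_poly D) S
  (skew_eval cf) skew_eval_is_zmod_morphism.

Lemma skew_evalC b : skew_eval cf (skewC D b) = f b.
Proof. by rewrite /skew_eval map_polyC hornerC. Qed.

Lemma skew_evalX : skew_eval cf (skewX D) = c.
Proof. by rewrite /skew_eval map_polyX hornerX. Qed.

(** The case p = x of multiplicativity, and the only place where compatibility enters; general p
    follows by splitting it into monomials b x^i. *)
Lemma skew_eval_skew_Xmul (q : {poly B}) :
  skew_eval cf (skew_Xmul D q : skew_poly D) = c * skew_eval cf q.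
Proof.
have evalMX (r : {poly B}) :
    skew_eval cf (r * 'X : {poly B}) = skew_eval cf r * c.
  by rewrite /skew_eval rmorphM /= map_polyX hornerMX.
elim/poly_ind: q => [|q b IHq]; first by rewrite !raddf0 mulr0.
(* Left and right multiplication by x commute, so the commutation rule is needed for the constant
   term [b] only. *)
have -> : skew_Xmul D (q * 'X + b%:P) =
    (skew_Xmul D q + (s b)%:P) * 'X + (d b)%:P.
  have map_dMX : map_poly d (q * 'X) = map_poly d q * 'X.
    by apply/polyP => -[|i]; rewrite coef_map !coefMX ?raddf0 // coef_map.
  rewrite /skew_Xmul !raddfD /= map_dMX rmorphM /= map_polyX !map_polyC /=.
  by rewrite !mulrDl -!addrA; congr (_ + _); rewrite addrCA.
have evalD (r r' : {poly B}) :
    skew_eval cf (r + r')%R = skew_eval cf r + skew_eval cf r'.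
  exact: (raddfD (skew_eval cf) r r').
have evalC e : skew_eval cf e%:P = f e by exact: skew_evalC.
rewrite !evalD !evalMX evalD IHq !evalC mulrDr cf mulrDl mulrA.
by rewrite -!addrA.
Qed.

Fact skew_eval_is_monoid_morphism : monoid_morphism (skew_eval cf).
Proof.
split=> [|p q]; first by rewrite [LHS](@skew_evalC 1) rmorph1.
have evalCM b r : skew_eval cf (skewC D b * r) = f b * skew_eval cf r.
  by rewrite skewC_mulE /skew_eval map_polyZ hornerZ.
elim/skew_monomial_ind: p => [|p1 p2 IH1 IH2|b i].
- by rewrite !(raddf0, mul0r).
- by rewrite mulrDl !raddfD mulrDl /= IH1 IH2.
rewrite -mulrA !evalCM -mulrA; congr (_ * _).
elim: i => [|i IHi].
  by rewrite !mul1r [skew_eval cf 1](@skew_evalC 1) rmorph1 mul1r.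
by rewrite exprS -mulrA !skewX_mulE !skew_eval_skew_Xmul IHi mulrA.
Qed.

HB.instance Definition _ := GRing.isMonoidMorphism.Build (skew_poly D) S
  (skew_eval cf) skew_eval_is_monoid_morphism.

End SkewEval.

(** * The skew Laurent ring L as a localization of A[y; alpha] *)

Section SkewLaurent.

Variables (K : nzRingType) (A : algType K) (alpha : alg_aut A).

Local Notation Ay := (skew_poly (skewA alpha)).
Local Notation L := (laurent alpha).
Local Notation y := (laurY alpha).

Lemma laur_monomialE a i : laurC alpha a * y i = << a *g i >> :> {malg A[int]}.
Proof. by rewrite [LHS]laur_mulUU mulr1 add0r. Qed.

Lemma laur_monomialM a i b j :
  (laurC alpha a * y i) * (laurC alpha b * y j) =
  laurC alpha (a * aut_pow alpha i b) * y (i + j).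
Proof.
apply: etrans (esym (laur_monomialE _ _)).
by rewrite -laur_mulUU -!laur_monomialE.
Qed.

Fact laurC_is_zmod_morphism : zmod_morphism (laurC alpha).
Proof. by move=> a b; rewrite /laurC monalgUB. Qed.

HB.instance Definition _ :=
  GRing.isZmodMorphism.Build A L (laurC alpha) laurC_is_zmod_morphism.

Fact laurC_is_monoid_morphism : monoid_morphism (laurC alpha).
Proof. by split=> // a b; rewrite [RHS]laur_mulUU addr0. Qed.

HB.instance Definition _ :=
  GRing.isMonoidMorphism.Build A L (laurC alpha) laurC_is_monoid_morphism.

Lemma laurYn (n : nat) : y 1 ^+ n = y n.
Proof. by elim: n => // n IHn; rewrite exprS IHn -laurYD. Qed.

Lemma laurYC i a : y i * laurC alpha a = laurC alpha (aut_pow alpha i a) * y i.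
Proof.
by rewrite [LHS]laur_mulUU [RHS]laur_mulUU mul1r mulr1 addr0 add0r.
Qed.

Lemma laurYK i : y i * y (- i) = 1.
Proof. by rewrite -laurYD subrr. Qed.

Lemma laurYVK i : y (- i) * y i = 1.
Proof. by rewrite -laurYD addNr. Qed.

Lemma laur_monomial_ind (Q : L -> Prop) :
    Q 0 -> (forall f g, Q f -> Q g -> Q (f + g)) ->
    (forall a i, Q (laurC alpha a * y i)) ->
  forall f, Q f.
Proof.
by move=> Q0 QD QM; apply: laur_ind => // a i; rewrite -laur_monomialE.
Qed.

Fact laurY_skew_compatible :
  @skew_compatible _ _ (skewA alpha) (laurC alpha) (y 1).
Proof. by move=> a; rewrite laurY_comm /= raddf0 addr0. Qed.

Definition skew_to_laur (p : Ay) : L := skew_eval laurY_skew_compatible p.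

HB.instance Definition _ :=
  GRing.RMorphism.copy skew_to_laur (skew_eval laurY_skew_compatible).

Local Notation iota := skew_to_laur.

Lemma skew_to_laurC a : iota (skewC (skewA alpha) a) = laurC alpha a.
Proof. exact: skew_evalC. Qed.

Lemma skew_to_laurX : iota (skewX (skewA alpha)) = y 1.
Proof. exact: skew_evalX. Qed.

Lemma skew_to_laur_inj : injective iota.
Proof.
apply: raddf_inj => p p0; apply/polyP => n; rewrite coef0.
have : (iota p : {malg A[int]})@_n%:Z = 0 by rewrite p0 mcoeff0.
have -> : (iota p : {malg A[int]})@_n%:Z =
    \sum_(i < size (p : {poly A})) (p : {poly A})`_i *+ (i == n :> nat).
  rewrite [p in iota p]skew_polyE rmorph_sum /= raddf_sum /=.
  apply: eq_bigr => i _.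
  rewrite [iota _]rmorphM rmorphXn /= skew_to_laurC skew_to_laurX laurYn laur_monomialE.
  by rewrite mcoeffU eqz_nat.
case: (ltnP n (size (p : {poly A}))) => [lt_n|le_n _]; last exact: nth_default.
rewrite (bigD1 (Ordinal lt_n)) //= eqxx big1 ?addr0 // => i.
by rewrite -val_eqE /= => /negbTE->.
Qed.

(** Only finitely many negative exponents occur, so one power of y clears them all. With its
    right-hand twin this makes L the two-sided localization of A[y; alpha] at the powers of y. *)
Lemma laur_clear_left (f : L) : exists n p, y (Posz n) * f = iota p.
Proof.
elim/laur_monomial_ind: f => [|f g [m [p def_p]] [n [q def_q]]|a i].
- by exists 0%N, 0; apply: etrans (mulr0 _) (esym (rmorph0 _)).
- exists (n + m)%N, (skewX _ ^+ n * p + skewX _ ^+ m * q).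
  rewrite [iota _]rmorphD !rmorphM !rmorphXn /= skew_to_laurX !laurYn -def_p -def_q.
  by rewrite !mulrA -!laurYD (addrC m%:Z) -mulrDr.
(* The exponent |i| works for both signs of [i], since |i| + i is non-negative. *)
exists (absz i), (skewC _ (aut_pow alpha (absz i) a) *
                  skewX _ ^+ absz (Posz (absz i) + i)).
rewrite [iota _]rmorphM rmorphXn /= skew_to_laurC skew_to_laurX laurYn.
rewrite mulrA laurYC -mulrA -laurYD; congr (_ * y _); lia.
Qed.

Lemma laur_clear_right (f : L) : exists n p, f * y (Posz n) = iota p.
Proof.
elim/laur_monomial_ind: f => [|f g [m [p def_p]] [n [q def_q]]|a i].
- by exists 0%N, 0; apply: etrans (mul0r _) (esym (rmorph0 _)).
- exists (m + n)%N, (p * skewX _ ^+ n + q * skewX _ ^+ m).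
  rewrite [iota _]rmorphD !rmorphM !rmorphXn /= skew_to_laurX !laurYn -def_p -def_q.
  by rewrite -!mulrA -!laurYD (addrC n%:Z) -mulrDl.
exists (absz i), (skewC _ a * skewX _ ^+ absz (Posz (absz i) + i)).
rewrite [iota _]rmorphM rmorphXn /= skew_to_laurC skew_to_laurX laurYn.
rewrite -mulrA -laurYD; congr (_ * y _); lia.
Qed.

Hypothesis A_domain : is_domain A.

Lemma skewA_domain : is_domain Ay.
Proof. by apply: skew_poly_domain A_domain; exact: can_inj (autK alpha). Qed.

(** Clearing [f] on the left and [g] on the right puts both powers of y outside the product [f * g],
    which reduces the claim to the domain A[y; alpha]. *)
Lemma laurent_domain : is_domain L.
Proof.
move=> f g fg0.
have [m [p def_p]] := laur_clear_left f.
have [n [q def_q]] := laur_clear_right g.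
have /skewA_domain : p * q = 0.
  apply: skew_to_laur_inj; rewrite [LHS]rmorphM /= -def_p -def_q.
  by rewrite mulrA -(mulrA _ f g) fg0 mulr0 mul0r; apply: esym (rmorph0 _).
case=> r0; [left|right]; move: def_p def_q; rewrite r0 raddf0.
  move=> /(congr1 (fun h => y (- m%:Z) * h)).
  by rewrite mulrA laurYVK mul1r mulr0.
move=> _ /(congr1 (fun h => h * y (- n%:Z))).
by rewrite -mulrA laurYK mulr1 mul0r.
Qed.

End SkewLaurent.

(** * The Casimir element and the map from R to L[Z] *)

Lemma polyXD_twist (S : nzRingType) (w b b' c : S) :
    w * b' = b' * w -> c * b = b' * c ->
  ('X + w%:P) * c%:P * b%:P = b'%:P * (('X + w%:P) * c%:P).
Proof.
move=> wb cb; rewrite -mulrA -rmorphM /= cb rmorphM /= !mulrA.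
by rewrite mulrDl mulrDr commr_polyX -!rmorphM /= wb.
Qed.

(** For w = u, c = y^-1 and c' = y this is the relation xy = yx + v satisfied by (Z + u) y^-1; the
    relation xa = alpha^-1(a) x comes from [polyXD_twist]. *)
Lemma polyXD_twist_inv (S : nzRingType) (w w' c c' : S) :
    c * c' = 1 -> c' * c = 1 -> c' * w = w' * c' ->
  ('X + w%:P) * c%:P * c'%:P = c'%:P * (('X + w%:P) * c%:P) + (w - w')%:P.
Proof.
move=> cc' c'c wc; rewrite -mulrA -rmorphM /= cc' mulr1.
rewrite mulrA mulrDr commr_polyX -rmorphM /= wc mulrDl -mulrA -!rmorphM /=.
rewrite c'c mulr1 -mulrA c'c mulr1 rmorphB /=.
by rewrite -addrA [_ + (_ - _)]addrC subrK.
Qed.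

(** The elements obeying the compatibility relation contain 1 and are closed under sums and products
    (this lemma and the next two), so the relation need only be checked on generators. *)
Lemma skew_compatibleD (B S : nzRingType) (D : skew_data B)
    (f : {rmorphism B -> S}) (c : S) (a b : B) :
    c * f a = f (sk_end D a) * c + f (sk_der D a) ->
    c * f b = f (sk_end D b) * c + f (sk_der D b) ->
  c * f (a + b) = f (sk_end D (a + b)) * c + f (sk_der D (a + b)).
Proof.
by move=> ca cb; rewrite !raddfD /= mulrDr ca cb mulrDl addrACA.
Qed.

Lemma skew_compatible1 (B S : nzRingType) (D : skew_data B)
    (f : {rmorphism B -> S}) (c : S) :
  c * f 1 = f (sk_end D 1) * c + f (sk_der D 1).
Proof. by rewrite sk_der1 !rmorph1 rmorph0 addr0 mul1r mulr1. Qed.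

Lemma skew_compatibleM (B S : nzRingType) (D : skew_data B)
    (f : {rmorphism B -> S}) (c : S) (a b : B) :
    c * f a = f (sk_end D a) * c + f (sk_der D a) ->
    c * f b = f (sk_end D b) * c + f (sk_der D b) ->
  c * f (a * b) = f (sk_end D (a * b)) * c + f (sk_der D (a * b)).
Proof.
move=> ca cb; rewrite sk_derM !(rmorphM, rmorphD) /= mulrA ca mulrDl.
by rewrite -mulrA cb mulrDr !mulrA addrA.
Qed.

Section Conformal.

Variables (K : nzRingType) (A : algType K) (alpha : alg_aut A).
Variables (u : A) (cu : central u).

Local Notation Ay := (skew_poly (skewA alpha)).
Local Notation L := (laurent alpha).
Local Notation cv := (central_conformal alpha cu).
Local Notation R := (ambiskew alpha cv).
Local Notation C := (ambiC alpha cv).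
Local Notation Y := (ambiY alpha cv).
Local Notation X := (ambiX alpha cv).
Local Notation z := (casimir alpha cu).

Lemma ambiskew_monomial_ind (Q : R -> Prop) :
    Q 0 -> (forall p q, Q p -> Q q -> Q (p + q)) ->
    (forall a i j, Q (C a * Y ^+ i * X ^+ j)) ->
  forall p, Q p.
Proof.
move=> Q0 QD QM; apply: skew_monomial_ind => // b j.
elim/skew_monomial_ind: b => [|p q Qp Qq|a i].
- by rewrite rmorph0 mul0r.
- by rewrite rmorphD mulrDl; apply: QD.
by rewrite rmorphM rmorphXn; apply: QM.
Qed.

Lemma ambiskew_central (c : R) :
  (forall a, c * C a = C a * c) -> c * Y = Y * c -> c * X = X * c -> central c.
Proof.
move=> cC cY cX; elim/ambiskew_monomial_ind => [|p q cp cq|a i j].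
- by rewrite mulr0 mul0r.
- by rewrite mulrDl mulrDr cp cq.
have cYi : GRing.comm c (Y ^+ i) by apply: commrX.
have cXj : GRing.comm c (X ^+ j) by apply: commrX.
by rewrite !mulrA cC -[C a * c * _]mulrA cYi mulrA -[_ * c * _]mulrA cXj mulrA.
Qed.

Lemma casimir_XY : X * Y = z + C u.
Proof. by rewrite /casimir subrK. Qed.

Lemma casimir_YX : Y * X = z + C (alpha u).
Proof.
apply: (addIr (C u)); rewrite addrAC -casimir_XY ambiXY -addrA -rmorphD.
by rewrite subrK.
Qed.

Lemma ambiC_central a : C u * C a = C a * C u.
Proof. by rewrite -!rmorphM cu. Qed.

(** Since v = u - alpha(u), z equals both xy - u and yx - alpha(u). Using one form on each side of
    the equation settles commutation with y and with x. *)
Lemma casimir_central : central z.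
Proof.
have zC a : z * C a = C a * z.
  rewrite /casimir mulrBl mulrBr ambiC_central -mulrA ambiY_comm mulrA.
  by rewrite ambiX_comm autK !mulrA.
have zE : z = Y * X - C (alpha u) by rewrite casimir_YX addrK.
apply: ambiskew_central => //.
  by rewrite {1}zE /casimir mulrBl mulrBr ambiY_comm mulrA.
by rewrite {2}zE /casimir mulrBl mulrBr ambiX_comm autK mulrA.
Qed.

Definition lpolyC (f : L) : {poly L} := f%:P.
HB.instance Definition _ := GRing.RMorphism.copy lpolyC (@polyC L).

Local Notation iota := (@skew_to_laur K A alpha).

Local Notation xi :=
  (('X + (laurC alpha u)%:P) * (laurY alpha (-1))%:P : {poly L}).

(** A and y generate A[y; alpha]. On A the condition is xa = alpha^-1(a) x, on y it is xy = yx + v,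
    both read for (Z + u) y^-1. *)
Fact xi_skew_compatible :
  @skew_compatible _ _ (ambiskew_data alpha cv) (lpolyC \o iota) xi.
Proof.
have xiC a : xi * (laurC alpha a)%:P = (laurC alpha (aut_inv alpha a))%:P * xi.
  apply: polyXD_twist; last exact: laurYC.
  by rewrite -rmorphM cu rmorphM.
have xiY : xi * (laurY alpha 1)%:P =
    (laurY alpha 1)%:P * xi + (laurC alpha u - laurC alpha (alpha u))%:P.
  by apply: polyXD_twist_inv; rewrite ?laurYC ?laurYK ?laurYVK.
elim/skew_monomial_ind => [|p q IHp IHq|a i].
- by rewrite (raddf0 (sk_der _)) !rmorph0 mul0r mulr0 addr0.
- exact: skew_compatibleD.
apply: skew_compatibleM.
  rewrite /= ambi_betaC ambi_deltaC !skew_to_laurC !rmorph0 addr0.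
  exact: xiC.
elim: i => [|i IHi]; first exact: skew_compatible1.
rewrite exprS; apply: skew_compatibleM; last exact: IHi.
rewrite /= ambi_betaX ambi_deltaX skew_to_laurX skew_to_laurC.
by rewrite [laurC _ (_ - _)]rmorphB; apply: xiY.
Qed.

(* Solving z = xy - u for x gives x = (z + u) y^-1, so R embeds into the
   polynomial ring over the skew Laurent ring whose variable is z. *)
Definition ambi_to_laur (r : R) : {poly L} := skew_eval xi_skew_compatible r.

HB.instance Definition _ :=
  GRing.RMorphism.copy ambi_to_laur (skew_eval xi_skew_compatible).

Local Notation phi := ambi_to_laur.

Lemma ambi_to_laurC a : phi (C a) = (laurC alpha a)%:P.
Proof. by rewrite [LHS]skew_evalC /= skew_to_laurC. Qed.

Lemma ambi_to_laurY : phi Y = (laurY alpha 1)%:P.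
Proof. by rewrite [LHS]skew_evalC /= skew_to_laurX. Qed.

Lemma ambi_to_laurX : phi X = xi.
Proof. exact: skew_evalX. Qed.

Lemma ambi_to_laur_casimir : phi z = 'X.
Proof.
rewrite /casimir [LHS]rmorphB /= [phi (X * Y)]rmorphM /= ambi_to_laurC.
rewrite ambi_to_laurX ambi_to_laurY -mulrA -rmorphM /= laurYVK mulr1.
exact: addrK.
Qed.

End Conformal.

(** * Specialization of Z and normal forms modulo z - w *)

Section HornerAt.

Variables (S : nzRingType) (c : S).

Definition horner_at (_ : central c) (p : {poly S}) : S := p.[c].

Hypothesis cc : central c.

Fact horner_at_is_zmod_morphism : zmod_morphism (horner_at cc).
Proof. by move=> p q; rewrite /horner_at hornerD hornerN. Qed.

Fact horner_at_is_monoid_morphism : monoid_morphism (horner_at cc).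
Proof.
split=> [|p q]; first exact: hornerC.
by rewrite /horner_at hornerM_comm //; apply: cc.
Qed.

HB.instance Definition _ := GRing.isZmodMorphism.Build {poly S} S
  (horner_at cc) horner_at_is_zmod_morphism.
HB.instance Definition _ := GRing.isMonoidMorphism.Build {poly S} S
  (horner_at cc) horner_at_is_monoid_morphism.

End HornerAt.

Lemma horner_map_poly (R S : nzRingType) (f : {rmorphism R -> S}) (c : S)
    (p : {poly R}) :
  (map_poly f p).[c] = \sum_(i < size p) f p`_i * c ^+ i.
Proof.
rewrite (@horner_coef_wide _ (size p)) ?size_poly //.
by apply: eq_bigr => i _; rewrite coef_map.
Qed.

Section CasimirQuotient.

Variables (K : nzRingType) (A : algType K) (alpha : alg_aut A).
Variables (u : A) (cu : central u).

Local Notation Ay := (skew_poly (skewA alpha)).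
Local Notation L := (laurent alpha).
Local Notation cv := (central_conformal alpha cu).
Local Notation R := (ambiskew alpha cv).
Local Notation C := (ambiC alpha cv).
Local Notation Y := (ambiY alpha cv).
Local Notation X := (ambiX alpha cv).
Local Notation z := (casimir alpha cu).
Local Notation phi := (@ambi_to_laur K A alpha u cu).
Local Notation y := (laurY alpha).

Lemma aut_pow_fixed w i : alpha w = w -> aut_pow alpha i w = w.
Proof.
move=> fw; have fwV : aut_inv alpha w = w by rewrite -{1}fw autK.
by case: i => n; elim: n => [|n /= IHn] //=; rewrite IHn ?fw ?fwV.
Qed.

Lemma laurC_central w : central w -> alpha w = w -> central (laurC alpha w).
Proof.
move=> cw fw; elim/laur_monomial_ind => [|f g IHf IHg|a i].
- by rewrite mulr0 mul0r.
- by rewrite mulrDr mulrDl IHf IHg.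
by rewrite mulrA -rmorphM cw rmorphM -!mulrA laurYC aut_pow_fixed.
Qed.

Lemma ambiYn_comm i a : Y ^+ i * C a = C (iter i alpha a) * Y ^+ i.
Proof.
elim: i a => [|i IHi] a; first by rewrite expr0 mul1r mulr1.
by rewrite exprSr -mulrA ambiY_comm mulrA IHi -mulrA -iterSr.
Qed.

Section Fixed.

(** [w] stands for a scalar l; being central and fixed by [alpha] makes z - w central in R and w
    central in L, so Z can be specialized at w. *)
Variable w : A.
Hypotheses (cw : central w) (fw : alpha w = w).

Local Notation zw := (z - C w).

Lemma casimirB_central : central zw.
Proof.
have cCw : central (C w).
  apply: ambiskew_central => [a||]; first by rewrite -!rmorphM cw.
    by rewrite ambiY_comm fw.
  by rewrite ambiX_comm -{2}fw autK.
by move=> r; rewrite mulrBl mulrBr casimir_central cCw.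
Qed.

(** Modulo z - w the product yx becomes the element w + alpha(u) of A, so adjacent pairs yx cancel
    until only powers of y or only powers of x remain. The trailing factor [X] keeps constant terms
    in the first summand alone. *)
Lemma casimir_normal_form r : exists r' p q,
  r = zw * r' + ((map_poly C p).[Y] + (map_poly C q).[X] * X).
Proof.
have YX : Y * X = zw + C (w + alpha u).
  by rewrite casimir_YX rmorphD /= addrA subrK.
have := casimirB_central; move: (z - C w) YX => c YX cc.
elim/ambiskew_monomial_ind: r
  => [|r1 r2 [r1' [p1 [q1 ->]]] [r2' [p2 [q2 ->]]]|a i j].
- by exists 0, 0, 0; rewrite mulr0 !raddf0 !horner0 mul0r !addr0.
- exists (r1' + r2'), (p1 + p2), (q1 + q2).
  rewrite !raddfD /= !hornerD mulrDl mulrDr addrACA; congr (_ + _).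
  by rewrite addrACA.
elim: i a j => [|i IHi] a [|j].
- exists 0, a%:P, 0; rewrite !expr0 !mulr1 mulr0 add0r map_polyC hornerC.
  by rewrite raddf0 horner0 mul0r addr0.
- exists 0, 0, (a *: 'X^j); rewrite expr0 mulr1 mulr0 raddf0 horner0 !add0r.
  by rewrite map_polyZ map_polyXn hornerZ hornerXn -mulrA -exprSr.
- exists 0, (a *: 'X^(i.+1)), 0; rewrite expr0 mulr1 mulr0 raddf0 horner0 mul0r.
  by rewrite add0r addr0 map_polyZ map_polyXn hornerZ hornerXn.
(* The inner yx is replaced by (z - w) + (w + alpha(u)); moving w + alpha(u) left past y^i applies
   alpha^i to it. *)
have [r' [p [q def_r]]] := IHi (a * iter i alpha (w + alpha u)) j.
exists (C a * Y ^+ i * X ^+ j + r'), p, q.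
have -> : C a * Y ^+ i.+1 * X ^+ j.+1 =
    c * (C a * Y ^+ i * X ^+ j) +
    C (a * iter i alpha (w + alpha u)) * Y ^+ i * X ^+ j.
  rewrite rmorphM -[C a * C _ * _]mulrA -ambiYn_comm mulrA cc.
  rewrite exprSr exprS !mulrA -[C a * Y ^+ i * Y * X]mulrA YX.
  by rewrite mulrDr mulrDl -[_ * c * _]mulrA cc !mulrA.
by rewrite def_r mulrDr addrA.
Qed.

Definition casimir_spec (r : R) : L := horner_at (laurC_central cw fw) (phi r).

HB.instance Definition _ := GRing.RMorphism.copy casimir_spec
  (horner_at (laurC_central cw fw) \o phi).

Local Notation psi := casimir_spec.

Lemma casimir_specC a : psi (C a) = laurC alpha a.
Proof. by rewrite /casimir_spec ambi_to_laurC; apply: hornerC. Qed.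

Lemma casimir_specY : psi Y = y 1.
Proof. by rewrite /casimir_spec ambi_to_laurY; apply: hornerC. Qed.

Lemma casimir_specX : psi X = laurC alpha (w + u) * y (-1).
Proof.
rewrite /casimir_spec ambi_to_laurX [LHS]rmorphM /= [laurC _ (_ + _)]rmorphD.
by congr (_ * _); [rewrite /horner_at hornerD hornerX hornerC|apply: hornerC].
Qed.

Lemma casimir_specB : psi zw = 0.
Proof.
rewrite [LHS]rmorphB /= casimir_specC /casimir_spec ambi_to_laur_casimir.
by rewrite /horner_at hornerX subrr.
Qed.

End Fixed.

End CasimirQuotient.

Lemma rmorph_kernelMD (R S : nzRingType) (f : {rmorphism R -> S})
    (c r a b : R) :
  f c = 0 -> f (c * r + (a + b)) = f a + f b.
Proof. by move=> fc; rewrite !rmorphD rmorphM /= fc mul0r add0r. Qed.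

(** * Complete primeness of (z - w)R *)

Section CompletelyPrime.

Variables (K : nzRingType) (A : algType K) (alpha : alg_aut A).
Variables (u : A) (cu : central u).
Hypothesis A_domain : is_domain A.

Local Notation Ay := (skew_poly (skewA alpha)).
Local Notation L := (laurent alpha).
Local Notation cv := (central_conformal alpha cu).
Local Notation R := (ambiskew alpha cv).
Local Notation C := (ambiC alpha cv).
Local Notation Y := (ambiY alpha cv).
Local Notation X := (ambiX alpha cv).
Local Notation z := (casimir alpha cu).
Local Notation phi := (@ambi_to_laur K A alpha u cu).
Local Notation y := (laurY alpha).

Lemma coef_laur_sum (I : finType) (c : I -> A) (k : I -> int) (n : int) :
  (\sum_i laurC alpha (c i) * y (k i) : {malg A[int]})@_n =
  \sum_i c i *+ (k i == n).
Proof.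
rewrite raddf_sum; apply: eq_bigr => i _.
by rewrite /= laur_monomialE mcoeffU.
Qed.

(** The twisted power c alpha^-1(c) ... alpha^-(n-1)(c), which is the coefficient of (c y^-1)^n. *)
Fixpoint laur_exp_coef (c : A) (n : nat) : A :=
  if n is m.+1 then laur_exp_coef c m * aut_pow alpha (- m%:Z) c else 1.

Lemma laur_exp_monomial c n :
  (laurC alpha c * y (-1)) ^+ n = laurC alpha (laur_exp_coef c n) * y (- n%:Z).
Proof.
elim: n => [|n IHn]; first by rewrite rmorph1 mul1r.
by rewrite exprSr IHn laur_monomialM -opprD -(PoszD n 1) addn1.
Qed.

Lemma laur_exp_coef_neq0 c n : c != 0 -> laur_exp_coef c n != 0.
Proof.
move=> c0; elim: n => [|n IHn]; first exact: oner_neq0.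
apply/eqP => /A_domain[/eqP|bc]; first exact/negP/IHn.
have := aut_powD alpha n (- n%:Z) c; rewrite bc subrr raddf0 /= => c_eq0.
by rewrite c_eq0 eqxx in c0.
Qed.

Section Fixed.

Variable w : A.
Hypotheses (cw : central w) (fw : alpha w = w) (wu0 : w + u != 0).

Local Notation zw := (z - C w).
Local Notation psi := (@casimir_spec K A alpha u cu w cw fw).

(** In the normal form, p(y) maps to powers y^i with i >= 0 and q(x) x to powers y^-(i+1), so no
    cancellation occurs between them. Since x maps to (w + u) y^-1, the coefficient of y^-(i+1) is
    q_i times a twisted power of w + u, nonzero by [wu0]; hence p = q = 0. *)
Lemma casimir_spec_eq0 r : psi r = 0 -> exists r', r = zw * r'.
Proof.
have [r' [p [q def_r]]] := casimir_normal_form cw fw r.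
have psiE : psi r = psi (map_poly C p).[Y] + psi ((map_poly C q).[X] * X).
  by rewrite def_r; apply: rmorph_kernelMD (casimir_specB cu cw fw).
have psip : psi (map_poly C p).[Y] =
    \sum_(i < size p) laurC alpha p`_i * y (Posz i).
  rewrite horner_map_poly [LHS]rmorph_sum; apply: eq_bigr => i _.
  by rewrite [LHS]rmorphM rmorphXn /= casimir_specC casimir_specY laurYn.
pose b := laur_exp_coef (w + u).
have psiq : psi ((map_poly C q).[X] * X) =
    \sum_(i < size q) laurC alpha (q`_i * b i.+1) * y (- i.+1%:Z).
  rewrite horner_map_poly mulr_suml [LHS]rmorph_sum; apply: eq_bigr => i _.
  rewrite -mulrA -exprSr [LHS]rmorphM rmorphXn /= casimir_specC casimir_specX.
  by rewrite laur_exp_monomial mulrA -rmorphM.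
rewrite psiE psip psiq => f0.
have coefE n : \sum_(i < size p) p`_i *+ (Posz i == n) +
    \sum_(i < size q) (q`_i * b i.+1) *+ (- i.+1%:Z == n) = 0.
  rewrite -(coef_laur_sum (fun i => p`_(nat_of_ord i))).
  rewrite -(coef_laur_sum (fun i => q`_(nat_of_ord i) * b i.+1)).
  by rewrite -mcoeffD f0 mcoeff0.
have p0 : p = 0.
  apply/polyP => n; rewrite coef0.
  case: (ltnP n (size p)) => [lt_n|le_n]; last exact: nth_default.
  have := coefE n; rewrite (bigD1 (Ordinal lt_n)) //= eqxx big1 => [|i].
    by rewrite big1 => [|i _]; rewrite ?addr0 // (_ : _ == _ = false) //; lia.
  by rewrite -val_eqE /= eqz_nat => /negbTE->.
have q0 : q = 0.
  apply/polyP => n; rewrite coef0.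
  case: (ltnP n (size q)) => [lt_n|le_n]; last exact: nth_default.
  have := coefE (- n.+1%:Z); rewrite p0 size_poly0 big_ord0 add0r.
  rewrite (bigD1 (Ordinal lt_n)) //= eqxx big1 => [|i].
    rewrite addr0 => /A_domain[] // /eqP; rewrite -[_ == _]negbK.
    by rewrite laur_exp_coef_neq0.
  by rewrite -val_eqE /= eqr_opp eqz_nat eqSS => /negbTE->.
exists r'; rewrite def_r p0 q0 !raddf0 !horner0 mul0r addr0.
exact: addr0.
Qed.

Lemma casimir_spec_kernel r : psi r = 0 <-> right_multiples zw r.
Proof.
split=> [/casimir_spec_eq0 //|[r' ->]].
by rewrite [LHS]rmorphM /= casimir_specB mul0r.
Qed.

Lemma casimir_completely_prime : completely_prime (right_multiples zw).
Proof.
split=> [|/casimir_spec_kernel/eqP|a b /casimir_spec_kernel ab].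
- split=> [|a b [a' ->] [b' ->]|r a [a' ->]|r a [a' ->]].
  + by exists 0; rewrite mulr0.
  + by exists (a' + b'); rewrite mulrDr.
  + by exists (r * a'); rewrite mulrA -casimirB_central // -mulrA.
  by exists (a' * r); rewrite mulrA.
- by rewrite [psi 1]rmorph1 oner_eq0.
have /(laurent_domain A_domain) : psi a * psi b = 0 by rewrite -rmorphM.
by case=> /casimir_spec_kernel; [left|right].
Qed.

End Fixed.

End CompletelyPrime.

(** * Injectivity of the map from R to L[Z] *)

Lemma mulpX_eq0 (S : nzRingType) (p : {poly S}) : 'X * p = 0 -> p = 0.
Proof.
rewrite -commr_polyX => pX; apply/polyP => i.
by have := congr1 (fun q : {poly S} => q`_i.+1) pX; rewrite coefMX !coef0.
Qed.

Section Embedding.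

Variables (K : nzRingType) (A : algType K) (alpha : alg_aut A).
Variables (u : A) (cu : central u).
Hypothesis A_domain : is_domain A.

Local Notation Ay := (skew_poly (skewA alpha)).
Local Notation cv := (central_conformal alpha cu).
Local Notation R := (ambiskew alpha cv).
Local Notation C := (ambiC alpha cv).
Local Notation z := (casimir alpha cu).
Local Notation phi := (@ambi_to_laur K A alpha u cu).

Lemma ambi_beta_inj : injective (@ambi_beta K A alpha).
Proof.
move=> p q pq; apply/polyP => i; apply: (can_inj (aut_invK alpha)).
by have := congr1 (fun r : {poly A} => r`_i) pq; rewrite !coef_map.
Qed.

Lemma ambiskew_domain : is_domain R.
Proof.
by apply: skew_poly_domain (skewA_domain A_domain); apply: ambi_beta_inj.
Qed.

(** With coefficients on the left, z = yx - alpha(u) has degree one in x and leading coefficient y,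
    and degrees in x add. *)
Lemma size_casimir_mul (r : R) : r != 0 ->
  (size (r : {poly Ay}) < size ((z * r)%R : {poly Ay}))%N.
Proof.
have size_z : (1 < size (z : {poly Ay}))%N.
  have coef_z : (z : {poly Ay})`_1 = skewX (skewA alpha).
    rewrite (_ : z = ambiY alpha cv * ambiX alpha cv - C (alpha u)); last first.
      by rewrite casimir_YX addrK.
    rewrite [LHS]coefB coefC subr0 /= skewC_mulE coefZ coefX /=.
    by rewrite -[LHS]/(_ * _) mulr1.
  rewrite ltnNge; apply/negP => /leq_sizeP/(_ 1%N (leqnn _)); rewrite coef_z.
  by move/eqP; rewrite -[_ == _]/('X == 0 :> {poly A}) polyX_eq0.
move=> r0; rewrite (@size_skew_mul _ (ambiskew_data alpha cv)) //; first last.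
- by apply/eqP => z0; rewrite z0 size_poly0 in size_z.
- exact: skewA_domain.
- exact: ambi_beta_inj.
have r_gt0 : (0 < size (r : {poly Ay}))%N.
  by rewrite (size_poly_gt0 (r : {poly Ay})).
have lt_pred (m n : nat) : (1 < m -> 0 < n -> n < (m + n).-1)%N by lia.
exact: lt_pred.
Qed.

(** Descent on the degree in x: an element of the kernel also vanishes under the specialization Z =
    0, so it is z r' (here u != 0 is the condition [wu0] for w = 0). As phi(z) = Z can be cancelled,
    r' lies in the kernel too, with smaller degree unless it is zero. *)
Lemma ambi_to_laur_inj : u != 0 -> injective phi.
Proof.
move=> u0; apply: raddf_inj => r.
have [n le_n] := ubnP (size (r : {poly Ay})).
elim: n r le_n => // n IHn r le_n phir.
have c0 : central (0 : A) by move=> a; rewrite mul0r mulr0.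
have f0 : alpha 0 = 0 by exact: rmorph0.
have uu : 0 + u != 0 by rewrite add0r.
have [|r' def_r] := @casimir_spec_eq0 K A alpha u cu A_domain 0 c0 f0 uu r.
  by rewrite /casimir_spec phir rmorph0.
rewrite rmorph0 subr0 in def_r.
suff r'0 : r' = 0 by rewrite def_r r'0 mulr0.
have [//|r'0] := eqVneq r' 0.
apply: IHn.
  apply: (@leq_trans (size (r : {poly Ay}))); last exact: le_n.
  by rewrite def_r; apply: size_casimir_mul.
apply: mulpX_eq0; rewrite -(@ambi_to_laur_casimir K A alpha u cu) -phir def_r.
exact: esym (rmorphM _ _ _).
Qed.

End Embedding.

(** * Prime ideals, polynomial rings over simple rings, localized ideals *)

Section IdealFacts.

Variable R : nzRingType.
Implicit Types (I J P : R -> Prop).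

Lemma idealN I a : is_ideal I -> I a -> I (- a).
Proof. by move=> idI Ia; rewrite -mulN1r; apply: idealMl. Qed.

Lemma idealB I a b : is_ideal I -> I a -> I b -> I (a - b).
Proof. by move=> idI Ia Ib; apply: idealD => //; apply: idealN. Qed.

(** Primeness is applied to aR and to the set of all s with a s in P; both are two-sided ideals
    because a is central. *)
Lemma prime_ideal_centralM P a b : prime_ideal P -> central a ->
  P (a * b) -> P a \/ P b.
Proof.
case=> idP _ primeP ca Pab.
have [||r s [r' ->] Pas|aP|bP] :=
  primeP (right_multiples a) (fun s => P (a * s)).
- split=> [|r s [r' ->] [s' ->]|r s [s' ->]|r s [s' ->]].
  + by exists 0; rewrite mulr0.
  + by exists (r' + s'); rewrite mulrDr.
  + by exists (r * s'); rewrite mulrA -ca -mulrA.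
  by exists (s' * r); rewrite mulrA.
- split=> [|r s Pr Ps|r s Ps|r s Ps].
  + by rewrite mulr0; apply: (ideal0 idP).
  + by rewrite mulrDr; apply: (idealD idP).
  + by rewrite mulrA ca -mulrA; apply: (idealMl idP).
  by rewrite mulrA; apply: (Defs.idealMr idP).
- by rewrite ca -mulrA; apply: (idealMl idP).
- by left; apply: aP; exists 1; rewrite mulr1.
by right; apply: bP.
Qed.

Lemma completely_prime_prime P : completely_prime P -> prime_ideal P.
Proof.
case=> idP P1 cP; split=> // I J idI idJ IJP.
have [[a [Ia nPa]]|nI] := classic (exists a, I a /\ ~ P a); last first.
  by left=> a Ia; apply: NNPP => nPa; apply: nI; exists a.
by right=> b Jb; case: (cP _ _ (IJP _ _ Ia Jb)).
Qed.

End IdealFacts.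

(* A nonzero element of least degree can be chosen monic, and then its
   commutators with constants have smaller degree. *)
Lemma simple_poly_ideal (S : nzRingType) (J : {poly S} -> Prop) (g : {poly S}) :
    simple_ring S -> is_ideal J -> J g -> g <> 0 ->
  exists f, [/\ J f, f <> 0 & forall i, central f`_i].
Proof.
move=> simS idJ Jg g0.
have : exists n g, [/\ J g, g <> 0 & forall i, (n <= i)%N -> g`_i = 0].
  by exists (size g), g; split=> // i; apply: nth_default.
case=> n; elim: n {g Jg g0} => [|n IHn] [g [Jg g0 gn]].
  by case: g0; apply/polyP => i; rewrite gn ?coef0.
have [/IHn //|minn] :=
  classic (exists g, [/\ J g, g <> 0 & forall i, (n <= i)%N -> g`_i = 0]).
have min0 h : J h -> (forall i, (n <= i)%N -> h`_i = 0) -> h = 0.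
  by move=> Jh hn; apply: NNPP => h0; apply: minn; exists h.
(* The degree n coefficients of elements of [J] of degree at most n form an ideal of S, nonzero by
   minimality; simplicity puts 1 in it, which gives a monic element. *)
pose I c := exists2 h, J h & h`_n = c /\ forall i, (n < i)%N -> h`_i = 0.
have idI : is_ideal I.
  split.
  - by exists 0; [apply: (ideal0 idJ) | split=> [|i _]; rewrite coef0].
  - move=> a b [h Jh [<- hn]] [k Jk [<- kn]]; exists (h + k).
      exact: (idealD idJ).
    by split=> [|i lt_i]; rewrite coefD // hn ?kn ?addr0.
  - move=> r a [h Jh [<- hn]]; exists (r%:P * h); first exact: (idealMl idJ).
    by split=> [|i lt_i]; rewrite coefCM // hn ?mulr0.
  move=> r a [h Jh [<- hn]]; exists (h * r%:P); first exact: (Defs.idealMr idJ).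
  by split=> [|i lt_i]; rewrite coefMC // hn ?mul0r.
have [I0|/(_ 1)[h Jh [h1 hn]]] := simS _ idI.
  case: g0; apply: min0 => // i; rewrite leq_eqVlt => /orP[/eqP<-|].
    by apply: I0; exists g.
  exact: gn.
exists h; split=> // [h0|i s].
  by have := oner_neq0 S; rewrite -h1 h0 coef0 eqxx.
have /(congr1 (fun p : {poly S} => p`_i)) : h * s%:P - s%:P * h = 0.
  apply: min0.
    apply: idealB => //; first exact: (Defs.idealMr idJ).
    exact: (idealMl idJ).
  move=> j; rewrite coefB coefMC coefCM leq_eqVlt => /orP[/eqP<-|lt_j].
    by rewrite h1 mul1r mulr1 subrr.
  by rewrite hn // mul0r mulr0 subrr.
by rewrite coefB coefMC coefCM coef0 => /eqP; rewrite subr_eq0 => /eqP.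
Qed.

Section Localization.

Variables (R S : nzRingType) (f : {rmorphism R -> S}) (y : R) (y' : S).
Hypotheses (yK : f y * y' = 1) (y'K : y' * f y = 1).
Hypothesis clear_left : forall s, exists n r, f y ^+ n * s = f r.
Hypothesis clear_right : forall s, exists n r, s * f y ^+ n = f r.

(* With powers of y on both sides this is a two-sided ideal of S although no
   chain condition is assumed. *)
Definition localized_ideal (I : R -> Prop) (s : S) : Prop :=
  exists n r, I r /\ f y ^+ n * s * f y ^+ n = f r.

Let yn'K n : y' ^+ n * f y ^+ n = 1.
Proof.
elim: n => [|n IHn]; first by rewrite mulr1.
by rewrite exprSr exprS -mulrA (mulrA y') y'K mul1r.
Qed.

Let ynK n : f y ^+ n * y' ^+ n = 1.
Proof.
elim: n => [|n IHn]; first by rewrite mulr1.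
by rewrite exprSr exprS -mulrA (mulrA (f y)) yK mul1r.
Qed.

Lemma localized_ideal_mem (I : R -> Prop) r : I r -> localized_ideal I (f r).
Proof. by move=> Ir; exists 0%N, r; split; rewrite // mul1r mulr1. Qed.

Lemma localized_ideal_is_ideal I : is_ideal I -> is_ideal (localized_ideal I).
Proof.
move=> idI; split.
- by exists 0%N, 0; split; [apply: (ideal0 idI) | rewrite mulr0 mul0r rmorph0].
- move=> a b [m [r [Ir def_r]]] [n [s [Is def_s]]].
  exists (m + n)%N, (y ^+ n * r * y ^+ n + y ^+ m * s * y ^+ m); split.
    apply: (idealD idI); apply: (Defs.idealMr idI); exact: (idealMl idI).
  rewrite rmorphD !rmorphM !rmorphXn /= -def_r -def_s mulrDr mulrDl.
  congr (_ + _).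
    by rewrite {1}addnC !exprD !mulrA.
  by rewrite {2}addnC !exprD !mulrA.
- move=> s a [n [r [Ir def_r]]].
  (* Clearing [s * y' ^+ n] instead of [s] leaves a factor [y' ^+ n] that absorbs the power of y
     standing to the left of [a]. *)
  have [m [t def_t]] := clear_left (s * y' ^+ n).
  exists (n + m)%N, (y ^+ n * t * r * y ^+ m); split.
    by apply: (Defs.idealMr idI); apply: (idealMl idI).
  rewrite !rmorphM !rmorphXn /= -def_r -def_t !exprD !mulrA.
  by rewrite -[_ * y' ^+ n * _]mulrA yn'K mulr1.
move=> s a [n [r [Ir def_r]]].
have [m [t def_t]] := clear_right (y' ^+ n * s).
exists (m + n)%N, (y ^+ m * r * t * y ^+ n); split.
  by apply: (Defs.idealMr idI); apply: (Defs.idealMr idI); apply: (idealMl idI).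
rewrite !rmorphM !rmorphXn /= -def_r -def_t !exprD !mulrA.
by rewrite -[_ * _ * y' ^+ n]mulrA ynK mulr1.
Qed.

End Localization.

(** * Polynomials in z, and clearing denominators in L[Z] *)

Lemma horner_divided_difference (K R : nzRingType) (h : {rmorphism K -> R})
    (c d : R) (p : {poly K}) : c * d = d * c ->
  exists t, (map_poly h p).[c] - (map_poly h p).[d] = t * (c - d).
Proof.
move=> cd; elim/poly_ind: p => [|p k [t def_t]].
  by exists 0; rewrite raddf0 !horner0 subrr mul0r.
(* From p(c)c - p(d)d = (p(c) - p(d))c + p(d)(c - d), where c commutes with c - d. *)
exists (t * c + (map_poly h p).[d]).
rewrite !rmorphD !rmorphM /= map_polyX map_polyC !hornerMXaddC.
rewrite opprD addrACA subrr addr0 mulrDl -mulrA.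
rewrite [c * _]mulrBr cd -mulrBl mulrA -def_t.
by rewrite mulrBl mulrBr addrA subrK.
Qed.

Lemma centralD (S : nzRingType) (a b : S) :
  central a -> central b -> central (a + b).
Proof. by move=> ca cb c; rewrite mulrDl mulrDr ca cb. Qed.

Lemma centralM (S : nzRingType) (a b : S) :
  central a -> central b -> central (a * b).
Proof. by move=> ca cb c; rewrite -mulrA cb mulrA ca mulrA. Qed.

(** The inductive step of [ambi_clear_left], along a decomposition p Z + c: y^m clears p, y^n clears
    c, and Z is already an image. *)
Lemma rmorph_clear_left (R S : nzRingType) (f : {rmorphism R -> {poly S}})
    (y r q z : R) (p : {poly S}) (c : {poly S}) m n :
    f y ^+ m * p = f r -> f q = f y ^+ n * c -> f z = 'X ->
  f y ^+ (n + m) * (p * 'X + c) = f (y ^+ n * r * z + y ^+ m * q).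
Proof.
move=> def_r def_q fz; rewrite rmorphD !rmorphM !rmorphXn /= -def_r def_q fz.
by rewrite mulrDr {2}addnC !exprD !mulrA.
Qed.

Lemma rmorph_clear_right (R S : nzRingType) (f : {rmorphism R -> {poly S}})
    (y r q z : R) (p : {poly S}) (c : {poly S}) m n :
    p * f y ^+ m = f r -> f q = c * f y ^+ n -> f z = 'X ->
  (p * 'X + c) * f y ^+ (m + n) = f (r * y ^+ n * z + q * y ^+ m).
Proof.
move=> def_r def_q fz; rewrite rmorphD !rmorphM !rmorphXn /= -def_r def_q fz.
by rewrite mulrDl -[p * 'X * _]mulrA -commr_polyX {2}addnC !exprD !mulrA.
Qed.

Section CasimirPolynomials.

Variables (K : fieldType) (A : algType K) (alpha : alg_aut A).
Variables (u : A) (cu : central u).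

Local Notation Ay := (skew_poly (skewA alpha)).
Local Notation L := (laurent alpha).
Local Notation cv := (central_conformal alpha cu).
Local Notation R := (ambiskew alpha cv).
Local Notation C := (ambiC alpha cv).
Local Notation Y := (ambiY alpha cv).
Local Notation X := (ambiX alpha cv).
Local Notation z := (casimir alpha cu).
Local Notation phi := (@ambi_to_laur K A alpha u cu).
Local Notation y := (laurY alpha).

Lemma scalar_central (k : K) : central (k%:A : A).
Proof. by move=> a; rewrite -scalerAl -scalerAr mul1r mulr1. Qed.

Lemma aut_scalar (k : K) : alpha k%:A = k%:A.
Proof. exact: rmorph_alg. Qed.

Definition casimir_poly (f : {poly K}) : R :=
  horner_at (@casimir_central K A alpha u cu) (map_poly (C \o in_alg A) f).

HB.instance Definition _ := GRing.RMorphism.copy casimir_poly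
  (horner_at (@casimir_central K A alpha u cu) \o map_poly (C \o in_alg A)).

Local Notation gz := casimir_poly.

Lemma casimir_polyX : gz 'X = z.
Proof. by rewrite /casimir_poly map_polyX /horner_at hornerX. Qed.

Lemma casimir_polyC k : gz k%:P = C k%:A.
Proof. by rewrite /casimir_poly map_polyC /horner_at hornerC. Qed.

Lemma casimir_poly_central f : central (gz f).
Proof.
elim/poly_ind: f => [|f k IHf].
  by rewrite rmorph0 => a; rewrite mul0r mulr0.
rewrite rmorphD rmorphM /= casimir_polyX casimir_polyC.
apply: centralD; first by apply: centralM => //; apply: casimir_central.
apply: ambiskew_central => [a||]; first by rewrite -!rmorphM scalar_central.
  by rewrite ambiY_comm aut_scalar.
by rewrite ambiX_comm -{2}(aut_scalar k) autK.
Qed.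

Lemma ambi_to_laur_casimir_poly f :
  phi (gz f) = map_poly (laurC alpha \o in_alg A) f.
Proof.
elim/poly_ind: f => [|f k IHf]; first by rewrite !rmorph0.
rewrite rmorphD rmorphM /= casimir_polyX casimir_polyC [LHS]rmorphD /=.
rewrite [phi (_ * _)]rmorphM /= IHf ambi_to_laur_casimir ambi_to_laurC.
by rewrite rmorphD rmorphM /= map_polyX map_polyC.
Qed.

(** Z is the image of z and the coefficients in L are cleared by powers of y, so L[Z] is obtained
    from R by inverting y. *)
Lemma ambi_clear_left (s : {poly L}) : exists n r, phi Y ^+ n * s = phi r.
Proof.
elim/poly_ind: s => [|p c [m [r def_r]]].
  by exists 0%N, 0; rewrite mulr0; apply: esym (rmorph0 _).
have [n [q def_q]] := laur_clear_left c.
exists (n + m)%N, (Y ^+ n * r * z + Y ^+ m * skewC (ambiskew_data alpha cv) q).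
have phiq : phi (skewC (ambiskew_data alpha cv) q) = phi Y ^+ n * c%:P.
  by rewrite [LHS]skew_evalC /= -def_q ambi_to_laurY -rmorphXn laurYn -rmorphM.
have phiz := ambi_to_laur_casimir alpha cu.
exact: rmorph_clear_left.
Qed.

Lemma ambi_clear_right (s : {poly L}) : exists n r, s * phi Y ^+ n = phi r.
Proof.
elim/poly_ind: s => [|p c [m [r def_r]]].
  by exists 0%N, 0; rewrite mul0r; apply: esym (rmorph0 _).
have [n [q def_q]] := laur_clear_right c.
exists (m + n)%N, (r * Y ^+ n * z + skewC (ambiskew_data alpha cv) q * Y ^+ m).
have phiq : phi (skewC (ambiskew_data alpha cv) q) = c%:P * phi Y ^+ n.
  by rewrite [LHS]skew_evalC /= -def_q ambi_to_laurY -rmorphXn laurYn -rmorphM.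
have phiz := ambi_to_laur_casimir alpha cu.
exact: rmorph_clear_right.
Qed.

End CasimirPolynomials.

(** * From a nonzero element of an ideal of R to an element z - l *)

Lemma rmorph_central_sandwich (R S : nzRingType) (f : {rmorphism R -> S})
    (y c : R) n : central c ->
  f y ^+ n * f c * f y ^+ n = f (y ^+ (n + n) * c).
Proof. by move=> cc; rewrite -!rmorphXn -!rmorphM exprD -!mulrA cc. Qed.

Section Ideals.

Variables (K : fieldType) (A : algType K) (alpha : alg_aut A).
Variables (u : A) (cu : central u).
Hypothesis A_domain : is_domain A.

Local Notation L := (laurent alpha).
Local Notation cv := (central_conformal alpha cu).
Local Notation R := (ambiskew alpha cv).
Local Notation C := (ambiC alpha cv).
Local Notation Y := (ambiY alpha cv).
Local Notation X := (ambiX alpha cv).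
Local Notation z := (casimir alpha cu).
Local Notation phi := (@ambi_to_laur K A alpha u cu).
Local Notation gz := (@casimir_poly K A alpha u cu).
Local Notation y := (laurY alpha).

(** The localized ideal contains a nonzero g with coefficients in the centre K, hence g = phi(f(z)).
    Membership means that y^n g y^n is the image of an element of I; as phi is injective and f(z)
    central, that element is y^(2n) f(z). *)
Lemma ideal_contains_Yn_casimir_poly (I : R -> Prop) (r : R) :
    u != 0 -> simple_ring L ->
    (forall c : L, central c -> exists k : K, c = laurC alpha k%:A) ->
    is_ideal I -> I r -> r != 0 ->
  exists m f, f != 0 /\ I (Y ^+ m * gz f).
Proof.
move=> u0 simL centL idI Ir r0.
have phiY : phi Y = (y 1)%:P by exact: ambi_to_laurY.
have YK : phi Y * (y (-1))%:P = 1 by rewrite phiY -rmorphM /= laurYK.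
have YVK : (y (-1))%:P * phi Y = 1 by rewrite phiY -rmorphM /= laurYVK.
have idJ := localized_ideal_is_ideal YK YVK (@ambi_clear_left _ _ _ _ cu)
  (@ambi_clear_right _ _ _ _ cu) idI.
have phir0 : phi r <> 0.
  move=> phir; case/eqP: r0; apply: (ambi_to_laur_inj A_domain u0).
  by rewrite phir; apply: esym (rmorph0 _).
have [g [[n [s [Is def_s]]] g0 /(_ _)/centL-gK]] :=
  simple_poly_ideal simL idJ (localized_ideal_mem _ _ Ir) phir0.
(* The boolean form lets [xchoose] select the scalar coefficients of [f]. *)
have {}gK i : exists k : K, g`_i == laurC alpha k%:A.
  by have [k ->] := gK i; exists k.
pose f := \poly_(i < size g) xchoose (gK i).
have fE : phi (gz f) = g.
  rewrite ambi_to_laur_casimir_poly; apply/polyP => i.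
  rewrite coef_map coef_poly.
  case: ltnP => [_|/(nth_default 0)->]; last exact: rmorph0.
  by have /eqP := xchooseP (gK i).
exists (n + n)%N, f; split.
  by apply/eqP => f0; apply: g0; rewrite -fE f0 [gz 0]rmorph0; apply: rmorph0.
suff <- : s = Y ^+ (n + n) * gz f by [].
apply: (ambi_to_laur_inj A_domain u0); rewrite -def_s -fE.
exact/rmorph_central_sandwich/casimir_poly_central.
Qed.

Lemma vsum_conformal m : vsum alpha (u - alpha u) m = u - iter m alpha u.
Proof.
rewrite /vsum; elim: m => [|m IHm]; first by rewrite big_ord0 subrr.
rewrite big_ord_recr /= IHm.
have -> : iter m alpha (u - alpha u) = iter m alpha u - iter m alpha (alpha u).
  exact: (rmorphB (aut_pow alpha m)).
by rewrite -iterSr addrA subrK.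
Qed.

Lemma central_iter m : central (iter m alpha u).
Proof.
elim: m => //= m IHm a; rewrite -[a](aut_invK alpha) -!rmorphM.
by rewrite IHm.
Qed.

Lemma ambiX_Yn m : X * Y ^+ m.+1 = (z + C u) * Y ^+ m.
Proof. by rewrite exprS mulrA casimir_XY. Qed.

Lemma ambiYn_X m : Y ^+ m.+1 * X = (z + C (iter m.+1 alpha u)) * Y ^+ m.
Proof.
rewrite exprSr -mulrA casimir_YX mulrDr ambiYn_comm -iterSr mulrDl.
by rewrite [z * _](@casimir_central K A alpha u cu).
Qed.

(** Subtracting the two preceding formulas cancels z and leaves u - alpha^(m+1)(u), the telescoped
    value of [vsum]. *)
Lemma commutator_Yn m :
  X * Y ^+ m.+1 - Y ^+ m.+1 * X = C (vsum alpha (u - alpha u) m.+1) * Y ^+ m.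
Proof.
rewrite ambiX_Yn ambiYn_X -mulrBl vsum_conformal [C (_ - _)]rmorphB.
congr (_ * _); by rewrite opprD addrACA subrr add0r.
Qed.

(* Modulo z + u, the polynomial p(u) becomes p(-z). *)
Lemma casimir_poly_shift (p : {poly K}) : exists t,
  C (horner_alg u p) = gz (p \Po - 'X) + t * (z + C u).
Proof.
have zCu : C u * - z = - z * C u.
  by rewrite mulrN mulNr (@casimir_central K A alpha u cu).
have [t def_t] := horner_divided_difference (C \o in_alg A) p zCu.
exists t; rewrite [z + _]addrC -[X in t * (_ + X)]opprK -def_t.
have -> : gz (p \Po - 'X) = (map_poly (C \o in_alg A) p).[- z].
  elim/poly_ind: p {def_t} => [|p k IHp].
    by rewrite comp_poly0 !raddf0 horner0.
  rewrite comp_poly_MXaddC !rmorphD /= !rmorphM /= map_polyX map_polyC.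
  by rewrite hornerMXaddC rmorphN /= casimir_polyX casimir_polyC IHp.
rewrite [RHS]addrC subrK /horner_alg /horner_morph !horner_map_poly rmorph_sum.
by apply: eq_bigr => i _; rewrite rmorphM rmorphXn.
Qed.

(** Each power of y is traded for a factor p(-z). Starting from y^(m+1) f(z) in I, the element y^m
    f(z) is driven into I by z + u ([I1]), by v^(m+1) ([I2]), hence by p(u) ([I3]), and so by p(-z)
    = p(u) - t (z + u). *)
Lemma lower_Yn (I : R -> Prop) m (f : {poly K}) :
    (forall m : nat, (1 <= m)%N -> exists2 p : {poly K}, p != 0 &
       exists a : A, horner_alg u p = vsum alpha (u - alpha u) m * a) ->
    is_ideal I -> f != 0 -> I (Y ^+ m * gz f) ->
  exists2 f', f' != 0 & I (gz f').
Proof.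
move=> p_exists idI; elim: m f => [|m IHm] f f0 If.
  by exists f; rewrite // -[gz f]mul1r.
have [p p0 [a def_a]] := p_exists m.+1 isT.
have [t def_t] := casimir_poly_shift p.
have cf := @casimir_poly_central K A alpha u cu f.
apply: (IHm ((p \Po - 'X) * f)).
  by rewrite mulf_neq0 // comp_poly2_eq0 // size_polyN size_polyX.
have I1 : I ((z + C u) * (Y ^+ m * gz f)).
  by rewrite mulrA -ambiX_Yn -mulrA; apply: (Defs.idealMl idI).
have I2 : I (C (vsum alpha (u - alpha u) m.+1) * (Y ^+ m * gz f)).
  rewrite mulrA -commutator_Yn mulrBl; apply: (idealB idI).
    by rewrite -mulrA; apply: (Defs.idealMl idI).
  by rewrite -mulrA -cf mulrA; apply: (Defs.idealMr idI).
have I3 : I (C (horner_alg u p) * (Y ^+ m * gz f)).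
  have cvs : central (vsum alpha (u - alpha u) m.+1).
    move=> b; rewrite vsum_conformal mulrBl mulrBr cu.
    by rewrite central_iter.
  by rewrite def_a cvs rmorphM /= -mulrA; apply: (Defs.idealMl idI).
rewrite rmorphM /= mulrA -(@casimir_poly_central _ _ _ _ cu (p \Po - 'X)).
rewrite -mulrA.
have -> : gz (p \Po - 'X) = C (horner_alg u p) - t * (z + C u).
  by rewrite def_t addrK.
rewrite mulrBl; apply: (idealB idI) => //.
by rewrite -mulrA; apply: (Defs.idealMl idI).
Qed.

(** All factors of f(z) are central, so P contains one of them; it is not the leading coefficient,
    which is a unit. *)
Lemma prime_contains_casimirB (P : R -> Prop) (f : {poly K}) :
    (exists rs : seq K, f = lead_coef f *: \prod_(l <- rs) ('X - l%:P)) ->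
    prime_ideal P -> f != 0 -> P (gz f) ->
  exists l : K, P (z - C l%:A).
Proof.
move=> [rs ->] primeP; rewrite scaler_eq0 lead_coef_eq0 negb_or => /andP[f0 _].
have [idP nP1 _] := primeP.
have split_P p q : P (gz p * q) -> P (gz p) \/ P q.
  exact/(prime_ideal_centralM primeP)/casimir_poly_central.
rewrite -mul_polyC rmorphM /= => /split_P.
case=> [Pc|].
  case: nP1; rewrite -[1](rmorph1 gz) -(@polyC1 K).
  rewrite -(mulVf (x := lead_coef f)) ?lead_coef_eq0 //.
  by rewrite polyCM rmorphM; apply: (Defs.idealMl idP).
elim: rs => [|l rs IHrs]; first by rewrite big_nil rmorph1.
rewrite big_cons rmorphM /= => /split_P.
case=> [Pl|//]; exists l.
by move: Pl; rewrite rmorphB /= casimir_polyX casimir_polyC.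
Qed.

End Ideals.

(** * Height one primes as a family of minimal nonzero primes *)

Section HeightOne.

Variable R : nzRingType.
Implicit Types P Q : R -> Prop.

Lemma ideal_eqP P Q : ideal_eq P Q -> P = Q.
Proof.
move=> PQ; apply: functional_extensionality => a.
exact: propositional_extensionality.
Qed.

Lemma ideal_lt_neq0 P Q : is_ideal P -> ideal_lt P Q -> exists2 a, Q a & a != 0.
Proof.
move=> idP [_ nQP]; apply: NNPP => nQ; apply: nQP => a Qa.
have [->|a0] := eqVneq a 0; first exact: ideal0.
by case: nQ; exists a.
Qed.

Lemma zero_ideal_prime : is_domain R -> prime_ideal (fun a : R => a = 0).
Proof.
move=> domR; apply: completely_prime_prime; split=> //; last by apply/eqP/oner_neq0.
split=> // [a b -> ->|r a ->|r a ->]; [exact: addr0|exact: mulr0|exact: mul0r].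
Qed.

(** Every nonzero prime contains some [M t], and no [M t] contains another, so these are exactly the
    minimal nonzero primes; as the zero ideal of a domain is prime, minimal nonzero means height
    one. *)
Lemma height_one_primes (T : Type) (M : T -> R -> Prop) :
    is_domain R -> (forall t, prime_ideal (M t)) ->
    (forall t, exists2 a, M t a & a != 0) ->
    (forall P a, prime_ideal P -> P a -> a != 0 ->
       exists t, ideal_sub (M t) P) ->
    (forall t t', ideal_sub (M t) (M t') -> t = t') ->
  forall P, height_one_prime P <-> exists t, ideal_eq P (M t).
Proof.
move=> domR primeM M_neq0 subM M_inj P.
have lt0M t : ideal_lt (fun a : R => a = 0) (M t).
  split=> [a ->|M0]; first by have [idM _ _] := primeM t; apply: ideal0.
  by have [a /M0->] := M_neq0 t; rewrite eqxx.
split=> [[primeP [[Q [primeQ ltQ eqQ]] nchain]]|[t /ideal_eqP->]].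
  move: eqQ ltQ => /ideal_eqP eqQ /(_ 0%N isT); rewrite eqQ => ltQP.
  have [idQ _ _] := primeQ 0%N isT.
  have [a Pa a0] := ideal_lt_neq0 idQ ltQP.
  have [t subMP] := subM P a primeP Pa a0.
  exists t => b; split; last exact: subMP.
  apply: NNPP => nPM; apply: nchain.
  (* If [M t] were strictly smaller than P, then 0 < M t < P would be a chain that height one
     forbids. *)
  pose Q' (i : nat) := if i is j.+1 then if j is 0%N then M t else P
                       else fun a : R => a = 0.
  have ltMP : ideal_lt (M t) P by split=> // subPM; apply/nPM/subPM.
  have primeZ := zero_ideal_prime domR.
  by exists Q'; split=> // [[|[|[|i]]] //= _|[|[|i]] //= _].
split; first exact: primeM.
split.
  exists (fun i => if i is 0%N then fun a : R => a = 0 else M t).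
  by split=> // [[|i] _|[|i] //]; [exact: zero_ideal_prime | exact: primeM].
(* In a chain Q 0 < Q 1 < M t, the nonzero prime [Q 1] contains some [M t']; then t' = t, which
   contradicts strictness. *)
case=> Q [primeQ ltQ /ideal_eqP eqQ].
have [idQ _ _] := primeQ 0%N isT.
have [a Qa a0] := ideal_lt_neq0 idQ (ltQ 0%N isT).
have [t' subMQ] := subM _ a (primeQ 1%N isT) Qa a0.
have [] := ltQ 1%N isT; rewrite eqQ => subQM nsub.
have tt' : t' = t by apply: M_inj => b /subMQ/subQM.
by apply: nsub; rewrite -tt'.
Qed.

End HeightOne.

(* [v_neq0] only excludes u in K (that is, v = 0 and xy = yx), where the
   conclusion fails: with A = K(t), alpha(t) = qt, q not a root of unity,
   and u = 0, the height one prime yR is not of the form (z - l)R, and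
   zR = xyR is not prime. *)
Theorem corollary2p4 (K : closedFieldType) (A : algType K)
    (alpha : alg_aut A) (u : A) (u_central : central u)
    (A_domain : is_domain A)
    (v_neq0 : u - alpha u != 0)
    (laurent_simple : simple_ring (laurent alpha))
    (laurent_centre : forall c : laurent alpha,
       central c <-> exists k : K, c = laurC alpha k%:A)
    (p_exists : forall m : nat, (1 <= m)%N ->
       exists2 p : {poly K}, p != 0 &
         exists a : A, horner_alg u p = vsum alpha (u - alpha u) m * a) :
  (forall P : ambiskew alpha (central_conformal alpha u_central) -> Prop,
     height_one_prime P <->
     exists l : K, ideal_eq P
       (right_multiples
          (casimir alpha u_central
           - ambiC alpha (central_conformal alpha u_central) l%:A)))
  /\ chatters_ufd (ambiskew alpha (central_conformal alpha u_central)).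
Proof.
(* If u = -l then [alpha] fixes u and v = 0. This is the condition for x to be nonzero modulo z -
   l. *)
have u_neq l : l%:A + u != 0.
  apply/eqP => /eqP; rewrite addrC addr_eq0 => /eqP u_l.
  by move/eqP: v_neq0; apply; rewrite u_l rmorphN /= aut_scalar subrr.
have u0 : u != 0 by have := u_neq 0; rewrite scale0r add0r.
set R := ambiskew _ _; set z := casimir alpha u_central.
pose C := ambiC alpha (central_conformal alpha u_central).
pose M (l : K) : R -> Prop := right_multiples (z - C l%:A).
have M_prime l : completely_prime (M l).
  exact: (casimir_completely_prime u_central A_domain (@scalar_central _ A l)
            (aut_scalar alpha l) (u_neq l)).
have M_gen l : M l (z - C l%:A) by exists 1; rewrite mulr1.
have R_domain : is_domain R by apply: ambiskew_domain.
have heightP (P : R -> Prop) :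
    height_one_prime P <-> exists l, ideal_eq P (M l).
  apply: height_one_primes => // [l|l|P' a primeP Pa a0|l l' sub].
  - exact: completely_prime_prime.
  - exists (z - C l%:A) => //; apply/eqP => zl0.
    (* [ambi_to_laur] sends z - l to the nonzero polynomial Z - l. *)
    have := ambi_to_laur_casimir_poly alpha u_central ('X - l%:P).
    rewrite rmorphB /= casimir_polyX casimir_polyC zl0 [LHS]rmorph0.
    rewrite rmorphB /= map_polyX map_polyC => /esym/eqP.
    by rewrite polyXsubC_eq0.
  - have [idP _ _] := primeP.
    have [m [f [f0 If]]] := ideal_contains_Yn_casimir_poly A_domain u0 laurent_simple
      (fun c => proj1 (laurent_centre c)) idP Pa a0.
    have [g g0 Ig] := lower_Yn p_exists idP f0 If.
    have [rs def_g] := closed_field_poly_normal g.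
    have [|l Pl] := prime_contains_casimirB _ primeP g0 Ig; first by exists rs.
    by exists l => b [r ->]; apply: (Defs.idealMr idP).
  have [idM nM1 _] := M_prime l'.
  apply/eqP; apply: contraT => ll'; case: nM1.
  (* With both z - l and z - l' in [M l'], their difference is a nonzero scalar there, hence a unit,
     and [M l'] would be the whole ring. *)
  have Mll' : M l' (C (l - l')%:A).
    have -> : C (l - l')%:A = (z - C l'%:A) - (z - C l%:A).
      by rewrite scalerBl [LHS]rmorphB opprB [RHS]addrC addrA subrK.
    exact: (idealB idM (M_gen l') (sub _ (M_gen l))).
  have -> : 1 = C (l - l')^-1%:A * C (l - l')%:A.
    rewrite -rmorphM -scalerAl mul1r scalerA mulVf ?subr_eq0 //.
    by rewrite scale1r rmorph1.
  exact: (Defs.idealMl idM).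
split=> //; split=> // [|P /heightP[l /ideal_eqP->]].
  by exists (M 0); apply/heightP; exists 0.
split=> //; exists (z - C l%:A); split=> // a; split=> -[r ->]; exists r.
  exact: casimirB_central (@scalar_central _ A l) (aut_scalar alpha l) r.
exact: esym (casimirB_central (@scalar_central _ A l) (aut_scalar alpha l) r).
Qed.
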